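(* The $\mathrm L$-Fourier transform $\mathcal F_{\mathrm L}$ is a bijective homeomorphism from $C^\infty_{\mathrm L}(\overline\Omega)$ to $\mathcal S(\mathcal I)$. Its inverse $\mathcal F_{\mathrm L}^{-1}:\mathcal S(\mathcal I)\to C^\infty_{\mathrm L}(\overline\Omega)$ is given by $$(\mathcal F_{\mathrm L}^{-1}h)(x)=\sum_{\xi\in\mathcal I}h(\xi)u_\xi(x),\quad h\in\mathcal S(\mathcal I),$$ so that $f(x)=\sum_{\xi\in\mathcal I}\widehat f(\xi)u_\xi(x)$ for all $f\in C^\infty_{\mathrm L}(\overline\Omega)$. Similarly, $\mathcal F_{\mathrm L^*}:C^\infty_{\mathrm L^*}(\overline\Omega)\to\mathcal S(\mathcal I)$ is a bijective homeomorphism and its inverse $\mathcal F_{\mathrm L^*}^{-1}:\mathcal S(\mathcal I)\to C^\infty_{\mathrm L^*}(\overline\Omega)$ is given by $$(\mathcal F_{\mathrm L^*}^{-1}h)(x)=\sum_{\xi\in\mathcal I}h(\xi)v_\xi(x),\quad h\in\mathcal S(\mathcal I),$$ so that $f(x)=\sum_{\xi\in\mathcal I}\widehat f_*(\xi)v_\xi(x)$ for all $f\in C^\infty_{\mathrm L^*}(\overline\Omega)$.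
   Context: Setting. $\Omega\subset\mathbb R^n$ ($n\ge 1$) is a bounded open set. $\mathrm L$ is a differential operator of order $m$ with smooth coefficients in $\Omega$, equipped with linear boundary conditions (the functions satisfying them form a linear space), viewed as an operator in $L^2(\Omega)$ with domain $\mathrm{Dom}(\mathrm L)$; $\mathrm L^*$ is its adjoint, with the adjoint boundary conditions and domain $\mathrm{Dom}(\mathrm L^* )$. $\mathcal I$ is a countable subset of some $\mathbb Z^K$; $\mathrm L$ has discrete spectrum $\{\lambda_\xi\}_{\xi\in\mathcal I}\subset\mathbb C$, listed with multiplicities so that $|\lambda_j|\le|\lambda_k|$ whenever $|j|\le|k|$. There are eigenfunctions $u_\xi\in\mathrm{Dom}(\mathrm L)$, $\mathrm Lu_\xi=\lambda_\xi u_\xi$, and $v_\xi\in\mathrm{Dom}(\mathrm L^* )$, $\mathrm L^*v_\xi=\overline{\lambda_\xi}v_\xi$, with $\|u_\xi\|_{L^2}=1$ and $(u_\xi,v_\eta)_{L^2}=\delta_{\xi\eta}$, where $(f,g)_{L^2}=\int_\Omega f\overline g\,dx$; both $\{u_\xi\}$ and $\{v_\xi\}$ are Riesz bases of $L^2(\Omega)$. Put $\langle\xi\rangle=(1+|\lambda_\xi|^2)^{1/(2m)}$. It is assumed that $\sum_{\xi\in\mathcal I}\langle\xi\rangle^{-s_0}<\infty$ for some $s_0\in\mathbb R$. Test functions: $C^\infty_{\mathrm L}(\overline\Omega)=\bigcap_{k\ge1}\mathrm{Dom}(\mathrm L^k)$, where $\mathrm{Dom}(\mathrm L^k)=\{f\in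 L^2(\Omega):\mathrm L^jf\in\mathrm{Dom}(\mathrm L),\ j=0,\dots,k-1\}$, with the topology of the norms $\max_{j\le k}\|\mathrm L^j\varphi\|_{L^2}$, $k\in\mathbb N_0$; $C^\infty_{\mathrm L^*}(\overline\Omega)$ is defined likewise from $\mathrm L^*$. Both are assumed closed under limits in these topologies (Fréchet spaces). $\mathcal S(\mathcal I)$ is the space of $\varphi:\mathcal I\to\mathbb C$ such that for every $M<\infty$ there is $C_{\varphi,M}$ with $|\varphi(\xi)|\le C_{\varphi,M}\langle\xi\rangle^{-M}$ for all $\xi$, topologised by the seminorms $p_k(\varphi)=\sup_\xi\langle\xi\rangle^k|\varphi(\xi)|$, $k\in\mathbb N_0$. Fourier transforms: $(\mathcal F_{\mathrm L}f)(\xi)=\widehat f(\xi)=\int_\Omega f(x)\overline{v_\xi(x)}\,dx$ for $f\in C^\infty_{\mathrm L}(\overline\Omega)$, and $(\mathcal F_{\mathrm L^*}f)(\xi)=\widehat f_*(\xi)=\int_\Omega f(x)\overline{u_\xi(x)}\,dx$ for $f\in C^\infty_{\mathrm L^*}(\overline\Omega)$. *)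

(* Defs.v *)
From HB Require Import structures.
From mathcomp Require Import all_boot all_order all_algebra.
From mathcomp Require Import ring_quotient generic_quotient.
From mathcomp Require Import complex.
From mathcomp Require Import all_classical all_reals all_analysis.
From mathcomp Require Import finmap measurable_realfun ring.
From mathcomp.analysis Require showcase.summability.

Set Implicit Arguments.
Unset Strict Implicit.
Unset Printing Implicit Defensive.

Import Order.TTheory GRing.Theory Num.Theory.
Import numFieldNormedType.Exports.

Local Open Scope classical_set_scope.
Local Open Scope ring_scope.

(* The sigma-algebra on R^n generated by the coordinate maps; it contains every
   open set (rV_open_measurable), so it is the Borel sigma-algebra. *)
Definition rV_display : measure_display. Proof. exact. Qed.

Section rV_measurable.
Context {R : realType} {n : nat}.

Definition rV_coord (i : 'I_n) (x : 'rV[R]_n) : measurableTypeR R := x ord0 i.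

Let rV_measurable := g_sigma_preimage rV_coord.

HB.instance Definition _ := @isMeasurable.Build rV_display 'rV[R]_n
  rV_measurable (@sigma_algebra0 _ _ _) (@sigma_algebraC _ _)
  (@sigma_algebra_bigcup _ _ _).

End rV_measurable.

Lemma measurable_rV_coord (R : realType) n (i : 'I_n) :
  measurable_fun [set: 'rV[R]_n] (rV_coord i).
Proof.
move=> _ Y mY; rewrite setTI; apply: sub_sigma_algebra => /=.
rewrite -bigcup_seq/=; exists i => /=; first by rewrite mem_index_enum.
by exists Y => //; rewrite setTI.
Qed.

Lemma measurable_fun_rV d (T : measurableType d) (R : realType) n
    (f : T -> 'rV[R]_n) :
  (forall i, measurable_fun [set: T] (rV_coord i \o f)) ->
  measurable_fun [set: T] f.
Proof.
move=> mf.
suff H : g_sigma_preimage (fun i => rV_coord i \o f) `<=` measurable.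
  by move=> _ A mA; apply: H; rewrite g_sigma_preimage_comp; exists A.
apply: smallest_sub; first exact: sigma_algebra_measurable.
case: n => [|n] in f mf *; first by rewrite big_ord0.
rewrite -bigcup_mkord_ord; apply: bigcup_sub => i Ii.
by move=> A [B mB <-]; exact: mf.
Qed.

Lemma rV_open_measurable (R : realType) n (U : set 'rV[R]_n) :
  open U -> measurable U.
Proof.
move=> oU.
pose D (q : 'rV[rat]_n * rat) : set 'rV[R]_n :=
  [set x : 'rV[R]_n | forall i, ball (x ord0 i) (ratr q.2) (ratr (q.1 ord0 i))].
pose F (q : 'rV[rat]_n * rat) : set 'rV[R]_n :=
  if `[< D q `<=` U >] then D q else set0.
have mD q : measurable (D q).
  pose G i : set 'rV[R]_n :=
    rV_coord i @^-1` (ball (ratr (q.1 ord0 i) : R) (ratr q.2 : R)).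
  have -> : D q = \bigcap_(i in [set: 'I_n]) G i.
    apply/seteqP; split => x /= Dx i; last first.
      by have := Dx i I; rewrite /G /= /rV_coord => /ball_sym.
    by move=> _; apply: ball_sym; exact: Dx.
  apply: fin_bigcap_measurable; first exact: finite_finset.
  move=> i _; rewrite -[X in measurable X]setTI.
  by apply: measurable_rV_coord => //; rewrite ball_itv; exact: measurable_itv.
have -> : U = \bigcup_q F q.
  apply/seteqP; split=> [x Ux|x [q _]]; last first.
    by rewrite /F; case: asboolP => // DU Dx; exact: DU.
  have /nbhs_ballP[e /= e0 eU] : nbhs x U by exact: open_nbhs_nbhs.
  have e20 : 0 < e / 2 by rewrite divr_gt0.
  have [r /andP[r0 re]] : exists r : rat, 0 < (ratr r : R) < (e : R) / 2.
    have [r] := @rat_in_itvoo R _ _ e20.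
    by rewrite in_itv /= => H; exists r.
  have H i : exists q : rat, `|x ord0 i - ratr q| < (ratr r : R).
    have [q] : exists q, (ratr q : R) \in `]x ord0 i - ratr r, x ord0 i + ratr r[.
      by apply: rat_in_itvoo; rewrite ltrBlDr -addrA ltrDl addr_gt0.
    rewrite in_itv /= => /andP[h1 h2]; exists q.
    by rewrite distrC ltr_distl h1 h2.
  pose q : 'rV[rat]_n := \row_i projT1 (cid (H i)).
  have qP i : `|x ord0 i - ratr (q ord0 i)| < ratr r.
    by rewrite mxE; exact: projT2 (cid (H i)).
  exists (q, r) => //; rewrite /F.
  case: asboolP => [_|]; first by move=> i; exact: qP.
  case=> y Dy; apply: eU; split => // i j; rewrite (ord1 i) /ball /=.
  rewrite (le_lt_trans (ler_distD (ratr (q ord0 j)) _ _))//.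
  by rewrite (splitr e) ltrD// (lt_trans _ re) ?qP// distrC; exact: Dy.
apply: countable_bigcupT_measurable => // q.
by rewrite /F; case: asboolP.
Qed.

(* (a, y) |-> (a, y_0, ..., y_(n-1)) *)
Definition rV_cons (R : realType) n (p : measurableTypeR R * 'rV[R]_n) :
  'rV[R]_n.+1 := \row_i (if unlift ord0 i is Some j then p.2 ord0 j else p.1).

Lemma measurable_rV_cons (R : realType) n : measurable_fun setT (@rV_cons R n).
Proof.
apply: measurable_fun_rV => i; case: (unliftP ord0 i) => [j ->|->].
  have -> : rV_coord (lift ord0 j) \o @rV_cons R n = rV_coord j \o snd.
    by apply/funext => p; rewrite /= /rV_coord mxE liftK.
  by apply: measurableT_comp => //; exact: measurable_rV_coord.
have -> : rV_coord ord0 \o @rV_cons R n = fst; last exact: measurable_fst.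
by apply/funext => p; rewrite /= /rV_coord mxE unlift_none.
Qed.

Section lebesgue_cons.
Local Open Scope ereal_scope.
Context {R : realType} {n : nat}.
Variable mu : {sigma_finite_measure set 'rV[R]_n -> \bar R}.

Definition leb_cons : set 'rV[R]_n.+1 -> \bar R :=
  pushforward (@lebesgue_measure R \x mu) (@rV_cons R n).

Let mf := @measurable_rV_cons R n.

Let leb_cons0 : leb_cons set0 = 0. Proof. exact: measure0. Qed.

Let leb_cons_ge0 A : 0 <= leb_cons A. Proof. exact: measure_ge0. Qed.

Let leb_cons_sigma_additive : semi_sigma_additive leb_cons.
Proof. exact: measure_semi_sigma_additive. Qed.

HB.instance Definition _ := isMeasure.Build _ _ _ leb_cons
  leb_cons0 leb_cons_ge0 leb_cons_sigma_additive.

Let leb_cons_sigma_finite : sigma_finite setT leb_cons.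
Proof.
have [F FT Ffin] : sigma_finite setT (@lebesgue_measure R \x mu).
  have /sigma_finiteP[A [TA ndA Aoo]] := sigma_finiteT (@lebesgue_measure R).
  have /sigma_finiteP[B [TB ndB Boo]] := sigma_finiteT mu.
  exists (fun k => A k `*` B k).
    rewrite -setXTT TA TB predeqE => -[x y]; split.
      move=> [/= [i _ Aix] [k _ Bky]]; exists (maxn i k) => //; split.
      - by move: x Aix; exact/subsetPset/ndA/leq_maxl.
      - by move: y Bky; exact/subsetPset/ndB/leq_maxr.
    by move=> [i _ []/= ? ?]; split; exists i.
  move=> k; have [? ?] := Aoo k; have [? ?] := Boo k.
  split; first exact: measurableX.
  by rewrite product_measure1E// lte_mul_pinfty// ge0_fin_numE.
pose g (x : 'rV[R]_n.+1) : measurableTypeR R * 'rV[R]_n :=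
  (x ord0 ord0, \row_i x ord0 (lift ord0 i)).
have fK : cancel (@rV_cons R n) g.
  move=> [a y]; rewrite /g /rV_cons mxE unlift_none; congr pair => /=.
  by apply/rowP => i; rewrite !mxE liftK.
have mg : measurable_fun setT g.
  apply/measurable_fun_pairP; split.
    exact: (@measurable_rV_coord R n.+1 ord0).
  apply: measurable_fun_rV => i.
  have -> : rV_coord i \o (snd \o g) = rV_coord (lift ord0 i).
    by apply/funext => x; rewrite /= /rV_coord mxE.
  exact: measurable_rV_coord.
exists (fun k => g @^-1` (F k)).
  by rewrite -preimage_bigcup -FT preimage_setT.
move=> k; have [mF Fk] := Ffin k; split.
  by rewrite -[X in measurable X]setTI; exact: mg.
rewrite /leb_cons /pushforward -comp_preimage.
suff -> : g \o @rV_cons R n = id by rewrite preimage_id.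
by apply/funext => x /=; rewrite fK.
Qed.

HB.instance Definition _ :=
  Measure_isSigmaFinite.Build _ _ _ leb_cons leb_cons_sigma_finite.

End lebesgue_cons.

(* Lebesgue measure on R^n, as the n-fold product of the one on R; on R^0 it is
   the unit mass at the only point. *)
Fixpoint lebesgue_rV (R : realType) n :
    {sigma_finite_measure set 'rV[R]_n -> \bar R} :=
  match n with
  | 0 => @dirac _ 'rV[R]_0 0 R
  | n'.+1 => leb_cons (lebesgue_rV R n')
  end.

Notation cmod := Normc.normc.

Section complex_L2.
Context d (T : measurableType d) (R : realType).
Variable mu : {measure set T -> \bar R}.

Definition cintegral (f : T -> R[i]) : R[i] :=
  Complex (\int[mu]_x complex.Re (f x)) (\int[mu]_x complex.Im (f x)).

Definition sq_integrable : {pred T -> R[i]^o} := fun f =>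
  `[< [/\ measurable_fun setT (fun x => complex.Re (f x)),
          measurable_fun setT (fun x => complex.Im (f x)) &
          (\int[mu]_x ((cmod (f x)) ^+ 2)%:E < +oo)%E ] >].

Lemma cmod_sq (z : R[i]) : cmod z ^+ 2 = complex.Re z ^+ 2 + complex.Im z ^+ 2.
Proof. by case: z => a b /=; rewrite sqr_sqrtr// addr_ge0// sqr_ge0. Qed.

Lemma sq_integrable_submod : submod_closed sq_integrable.
Proof.
split.
  apply/asboolP; split; [exact: measurable_cst|exact: measurable_cst|].
  under eq_integral do rewrite cmod_sq /= expr0n addr0.
  by rewrite integral0 ltry.
move=> a f g /asboolP[mfR mfI ff] /asboolP[mgR mgI fg].
have ReE x : complex.Re ((a *: f + g) x) =
    complex.Re a * complex.Re (f x) - complex.Im a * complex.Im (f x) + complex.Re (g x).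
  by rewrite /GRing.scale /= /GRing.add /=; case: (a) (f x) (g x) => [? ?] [? ?] [? ?].
have ImE x : complex.Im ((a *: f + g) x) =
    complex.Re a * complex.Im (f x) + complex.Im a * complex.Re (f x) + complex.Im (g x).
  by rewrite /GRing.scale /= /GRing.add /=; case: (a) (f x) (g x) => [? ?] [? ?] [? ?].
have mR : measurable_fun setT (fun x => complex.Re ((a *: f + g) x)).
  under eq_fun do rewrite ReE.
  apply: measurable_funD => //.
  by apply: measurable_funB => //; apply: measurable_funM => //; exact: measurable_cst.
have mI : measurable_fun setT (fun x => complex.Im ((a *: f + g) x)).
  under eq_fun do rewrite ImE.
  apply: measurable_funD => //.
  by apply: measurable_funD => //; apply: measurable_funM => //; exact: measurable_cst.
have msq (h : T -> R[i]) : measurable_fun setT (fun x => complex.Re (h x)) ->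
    measurable_fun setT (fun x => complex.Im (h x)) ->
    measurable_fun setT (fun x => (cmod (h x) ^+ 2)%:E).
  move=> hR hI; apply/measurable_EFinP; under eq_fun do rewrite cmod_sq.
  by apply: measurable_funD; exact: measurable_funX.
apply/asboolP; split => //.
pose C := 2 * cmod a ^+ 2.
have C0 : 0 <= C by rewrite mulr_ge0// sqr_ge0.
have le x : cmod ((a *: f + g) x) ^+ 2 <= C * cmod (f x) ^+ 2 + 2 * cmod (g x) ^+ 2.
  rewrite /C !cmod_sq ReE ImE.
  move: (complex.Re a) (complex.Im a) (complex.Re (f x)) (complex.Im (f x))
    (complex.Re (g x)) (complex.Im (g x)) => a1 a2 b1 b2 c1 c2.
  rewrite -subr_ge0.
  have -> : 2 * (a1 ^+ 2 + a2 ^+ 2) * (b1 ^+ 2 + b2 ^+ 2) + 2 * (c1 ^+ 2 + c2 ^+ 2)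
    - ((a1 * b1 - a2 * b2 + c1) ^+ 2 + (a1 * b2 + a2 * b1 + c2) ^+ 2)
    = (a1 * b1 - a2 * b2 - c1) ^+ 2 + (a1 * b2 + a2 * b1 - c2) ^+ 2.
    by ring.
  by rewrite addr_ge0// sqr_ge0.
apply: (@le_lt_trans _ _
    (\int[mu]_x (C%:E * (cmod (f x) ^+ 2)%:E + 2%:E * (cmod (g x) ^+ 2)%:E))%E).
  apply: ge0_le_integral => //.
  - by move=> x _; rewrite lee_fin sqr_ge0.
  - exact: msq.
  - apply: emeasurable_funD; apply: emeasurable_funM; try exact: measurable_cst; exact: msq.
  - by move=> x _; rewrite -!EFinM -EFinD lee_fin; exact: le.
have p0 (h : T -> R[i]) (c : R) : 0 <= c -> forall x, setT x -> (0 <= c%:E * (cmod (h x) ^+ 2)%:E)%E.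
  by move=> c0 x _; rewrite -EFinM lee_fin mulr_ge0// sqr_ge0.
rewrite ge0_integralD//; last 4 first.
- exact: p0.
- by apply: emeasurable_funM; [exact: measurable_cst|exact: msq].
- exact: p0.
- by apply: emeasurable_funM; [exact: measurable_cst|exact: msq].
rewrite ge0_integralZl//; last 2 first.
- exact: msq.
- by move=> x _; rewrite lee_fin sqr_ge0.
rewrite ge0_integralZl//; last 2 first.
- exact: msq.
- by move=> x _; rewrite lee_fin sqr_ge0.
by rewrite lte_add_pinfty// lte_mul_pinfty// ge0_fin_numE.
Qed.

HB.instance Definition _ :=
  GRing.isSubmodClosed.Build R[i] (T -> R[i]^o) sq_integrable sq_integrable_submod.

Record L2fun := MkL2fun { L2fun_val :> T -> R[i]^o; _ : L2fun_val \in sq_integrable }.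

HB.instance Definition _ := [isSub for L2fun_val].
HB.instance Definition _ := [Choice of L2fun by <:].
HB.instance Definition _ := [SubChoice_isSubLmodule of L2fun by <:].

Definition ae_null : {pred L2fun} := fun f => `[< {ae mu, forall x, f x = 0} >].

Lemma ae_null_submod : submod_closed ae_null.
Proof.
split; first by apply/asboolP; apply: aeW.
move=> a f g /asboolP f0 /asboolP g0; apply/asboolP.
apply: filterS2 f0 g0 => x fx gx.
rewrite -[LHS]/(a *: f x + g x).
by rewrite fx gx scaler0 addr0.
Qed.

HB.instance Definition _ :=
  GRing.isSubmodClosed.Build R[i] L2fun ae_null ae_null_submod.

(* L^2(mu) with complex values: square-integrable functions modulo the
   subspace of those that vanish almost everywhere. *)
Definition L2 := Quotient.quot ae_null.
HB.instance Definition _ := GRing.Zmodule.on L2.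
HB.instance Definition _ := EqQuotient.on L2.

(* a representative of the class f, determined up to a null set *)
Definition L2eval (f : L2) : T -> R[i] := L2fun_val (repr f).

Let scale (a : R[i]) (f : L2) : L2 := \pi_L2%qT (a *: repr f).

Let piZ a f : scale a (\pi_L2%qT f) = \pi_L2%qT (a *: f).
Proof.
apply/eqP; rewrite -Quotient.idealrBE -scalerBr; apply: rpredZ.
by rewrite Quotient.idealrBE reprK.
Qed.
Let piD f g : \pi_L2%qT (f + g) = \pi_L2%qT f + \pi_L2%qT g :> L2.
Proof. exact: pi_addr. Qed.

Let scaleA a b f : scale a (scale b f) = scale (a * b) f.
Proof. by rewrite -[f]reprK (piZ b) (piZ a) (piZ (a * b)) scalerA. Qed.
Let scale1 : left_id 1 scale.
Proof. by move=> f; rewrite -[f]reprK (piZ 1) scale1r. Qed.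
Let scaleDr : right_distributive scale +%R.
Proof.
by move=> a f g; rewrite -[f]reprK -[g]reprK -piD (piZ a) (piZ a) (piZ a) -piD scalerDr.
Qed.
Let scaleDl f : {morph scale^~ f : a b / a + b}.
Proof. by move=> a b; rewrite -[f]reprK (piZ (a + b)) (piZ a) (piZ b) -piD scalerDl. Qed.

HB.instance Definition _ :=
  GRing.Zmodule_isLmodule.Build R[i] L2 scaleA scale1 scaleDr scaleDl.

Definition L2inner (f g : L2) : R[i] := cintegral (fun x => L2eval f x * conjc (L2eval g x)).

Definition L2norm (f : L2) : R := Num.sqrt (\int[mu]_x (cmod (L2eval f x) ^+ 2)).

End complex_L2.

Section operators.
Context {K : pzRingType} {V : lmodType K}.

Definition linear_subspace (D : set V) : Prop :=
  D 0 /\ forall a x y, D x -> D y -> D (a *: x + y).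

(* A possibly unbounded linear operator: op_fun is meaningful on dom only. *)
Record operator := Operator {
  dom : set V;
  op_fun :> V -> V;
  dom_linear : linear_subspace dom;
  op_linear : forall a x y, dom x -> dom y ->
    op_fun (a *: x + y) = a *: op_fun x + op_fun y }.

Definition dom_pow (A : operator) (k : nat) : set V :=
  [set f | forall j, (j < k)%N -> dom A (iter j A f)].

Definition smooth_dom (A : operator) : set V :=
  \bigcap_(k in [set k | (1 <= k)%N]) dom_pow A k.

End operators.
Arguments operator {K} V.

Section gauge.
Context {R : realType} {T : choiceType}.

(* T with the coarsest topology that makes every ball {g | p k f g < e} open;
   when each p k is a pseudo-distance, as below, the finite intersections of
   balls centred at f form a neighbourhood basis of f. *)
Definition gauge_space (p : nat -> T -> T -> R) : Type := T.

Variable p : nat -> T -> T -> R.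

HB.instance Definition _ := Choice.on (gauge_space p).

Definition gauge_balls : set (set T) :=
  [set B | exists k f (e : R), 0 < e /\ B = [set g | p k f g < e]].

HB.instance Definition _ :=
  @isSubBaseTopological.Build (gauge_space p) (set T) gauge_balls id.

End gauge.

Section hilbert.
Context d (T : measurableType d) (R : realType).
Variable mu : {measure set T -> \bar R}.
Local Notation H := (L2 mu).

Definition is_adjoint (A B : operator H) : Prop :=
  dom B = [set g | exists h, forall f, dom A f -> L2inner (A f) g = L2inner f h] /\
  (forall f g, dom A f -> dom B g -> L2inner (A f) g = L2inner f (B g)).

Definition resolvent_set (A : operator H) : set R[i] :=
  [set z | (forall g, exists! f, dom A f /\ A f - z *: f = g) /\
     (exists c : R, forall f, dom A f -> L2norm f <= c * L2norm (A f - z *: f))].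

Definition spectrum (A : operator H) : set R[i] := ~` resolvent_set A.

(* The spectrum of A is {lam i | i in I}, it consists of isolated eigenvalues of
   finite multiplicity, and every eigenvalue z is listed as many times as its
   multiplicity: the u i with lam i = z span the eigenspace of z. *)
Definition discrete_spectrum (A : operator H) (I : choiceType) (lam : I -> R[i])
    (u : I -> H) : Prop :=
  [/\ spectrum A = range lam,
      forall i, exists2 e : R, 0 < e &
        forall j, cmod (lam j - lam i) < e -> lam j = lam i,
      forall z, finite_set [set i | lam i = z] &
      forall z f, dom A f -> A f = z *: f ->
        exists c : I -> R[i], f = \sum_(i <- fset_set [set i | lam i = z]) c i *: u i].

(* A Riesz sequence whose linear span is dense *)
Definition riesz_basis (I : choiceType) (u : I -> H) : Prop :=
  (exists a b : R, [/\ 0 < a, 0 < b & forall (s : {fset I}) (c : I -> R[i]),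
     a * (\sum_(i <- s) cmod (c i) ^+ 2) <= L2norm (\sum_(i <- s) c i *: u i) ^+ 2 /\
     L2norm (\sum_(i <- s) c i *: u i) ^+ 2 <= b * (\sum_(i <- s) cmod (c i) ^+ 2)]) /\
  (forall f (e : R), 0 < e -> exists (s : {fset I}) (c : I -> R[i]),
     L2norm (f - \sum_(i <- s) c i *: u i) < e).

Definition graph_norm (A : operator H) (k : nat) (f : H) : R :=
  \big[Num.max/0]_(j < k.+1) L2norm (iter j A f).

Definition smooth_space (A : operator H) : topologicalType :=
  gauge_space (fun k (f g : set_type (smooth_dom A)) =>
    graph_norm A k (\val f - \val g)).

Definition smooth_val (A : operator H) (f : smooth_space A) : H :=
  \val (f : set_type (smooth_dom A)).

(* The seminorms are countably many, so that sequences suffice. *)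
Definition closed_under_limits (A : operator H) : Prop :=
  forall f : nat -> smooth_space A,
    (forall k (e : R), 0 < e -> exists N, forall i j, (N <= i)%N -> (N <= j)%N ->
      graph_norm A k (smooth_val (f i) - smooth_val (f j)) < e) ->
    exists g : smooth_space A, f @ \oo --> g.

(* f = \sum_i h i *: u i: the net of the partial sums over the finite sets of
   indices converges to f for each of the norms defining the topology of
   smooth_space A, and pointwise almost everywhere. *)
Definition expansion (A : operator H) (I : choiceType) (h : I -> R[i])
    (u : I -> H) (f : H) : Prop :=
  (forall k, graph_norm A k (\sum_(i <- s) h i *: u i - f)
     @[s --> @summability.totally I] --> (0 : R)) /\
  {ae mu, forall x, cmod (\sum_(i <- s) h i * L2eval (u i) x - L2eval f x)
     @[s --> @summability.totally I] --> (0 : R)}.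

End hilbert.

Section schwartz.
Context {R : realType} {I : choiceType}.

Definition japanese (m : nat) (lam : I -> R[i]) (i : I) : R :=
  (1 + cmod (lam i) ^+ 2) `^ (2 * m%:R)^-1.

Variable w : I -> R.

Definition rapidly_decreasing : set (I -> R[i]) :=
  [set phi | forall M : R, exists C : R,
     forall i, cmod (phi i) <= C * (w i `^ (- M))].

Definition schwartz_norm (k : nat) (phi : I -> R[i]) : R :=
  sup [set w i ^+ k * cmod (phi i) | i in [set: I]].

Definition schwartz : topologicalType :=
  gauge_space (fun k (phi psi : set_type rapidly_decreasing) =>
    schwartz_norm k (\val phi - \val psi)).

Definition schwartz_val (phi : schwartz) : I -> R[i] :=
  \val (phi : set_type rapidly_decreasing).

End schwartz.

Section fourier.
Context d (T : measurableType d) (R : realType).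
Variable mu : {measure set T -> \bar R}.
Local Notation H := (L2 mu).
Context {I : choiceType}.

Definition fourier (v : I -> H) (f : H) : I -> R[i] :=
  fun i => L2inner f (v i).

Definition fourier_homeomorphism (A : operator H) (u v : I -> H) (w : I -> R) : Prop :=
  exists (F : smooth_space A -> schwartz w) (G : schwartz w -> smooth_space A),
  [/\ forall f, schwartz_val (F f) = fourier v (smooth_val f),
      cancel F G /\ cancel G F,
      continuous F /\ continuous G,
      forall h, expansion A (schwartz_val h) u (smooth_val (G h)) &
      forall f : smooth_space A, expansion A (fourier v (smooth_val f)) u (smooth_val f)].

End fourier.

Definition lattice_norm (R : realType) K (j : 'rV[int]_K) : R :=
  Num.sqrt (\sum_i ((j ord0 i)%:~R ^+ 2)).

Section differential_operators.
Context {R : realType} {n : nat}.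
Local Notation E := 'rV[R]_n.

Definition partial (i : 'I_n) (f : E -> R[i]) : E -> R[i] := fun x =>
  Complex ('D_(delta_mx ord0 i) (fun y => complex.Re (f y)) x)
          ('D_(delta_mx ord0 i) (fun y => complex.Im (f y)) x).

Definition partials (s : seq 'I_n) (f : E -> R[i]) : E -> R[i] :=
  foldr partial f s.

Definition smooth_on (U : set E) (f : E -> R[i]) : Prop :=
  forall (s : seq 'I_n) (x : E), U x ->
    [/\ {for x, continuous (fun y => complex.Re (partials s f y))},
        {for x, continuous (fun y => complex.Im (partials s f y))} &
        forall i,
          derivable (fun y => complex.Re (partials s f y)) x (delta_mx ord0 i) /\
          derivable (fun y => complex.Im (partials s f y)) x (delta_mx ord0 i)].

Definition test_function (U : set E) (phi : E -> R[i]) : Prop :=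
  smooth_on setT phi /\
  exists K, [/\ compact K, K `<=` U & forall x, ~ K x -> phi x = 0].

Definition mderiv m (al : {ffun 'I_n -> 'I_m.+1}) (f : E -> R[i]) : E -> R[i] :=
  partials (flatten [seq nseq (al i) i | i <- enum 'I_n]) f.

(* A multi-index of order at most m has entries at most m; the functions
   al : {ffun 'I_n -> 'I_m.+1} with morder al <= m are these multi-indices. *)
Definition morder m (al : {ffun 'I_n -> 'I_m.+1}) : nat := \sum_i al i.

Section on_domain.
Variables (Omega : set E) (oOmega : open Omega).

Definition leb_on : {measure set E -> \bar R} :=
  mrestr (lebesgue_rV R n) (rV_open_measurable oOmega).

(* The expression \sum_(|al| <= m) a al * d^al has smooth coefficients in Omega
   and is of order exactly m. *)
Definition smooth_coefs_order m (a : {ffun 'I_n -> 'I_m.+1} -> E -> R[i]) : Prop :=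
  (forall al, smooth_on Omega (a al)) /\
  (exists al x, [/\ morder al = m, Omega x & a al x != 0]).

(* g = \sum_(|al| <= m) a al * d^al f in the sense of distributions in Omega *)
Definition weak_diff_op m (a : {ffun 'I_n -> 'I_m.+1} -> E -> R[i])
    (f g : L2 leb_on) : Prop :=
  forall phi, test_function Omega phi ->
    cintegral leb_on (fun x => L2eval g x * phi x) =
    \sum_(al | (morder al <= m)%N) (-1) ^+ morder al *
      cintegral leb_on (fun x => L2eval f x * mderiv al (fun y => a al y * phi y) x).

(* The domain of L consists of the f in L^2(Omega) which satisfy the boundary
   conditions BC and to which the differential expression can be applied within
   L^2(Omega). *)
Definition boundary_operator m (a : {ffun 'I_n -> 'I_m.+1} -> E -> R[i])
    (BC : set (L2 leb_on)) (L : operator (L2 leb_on)) : Prop :=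
  linear_subspace BC /\
  dom L = BC `&` [set f | exists g, weak_diff_op a f g] /\
  (forall f, dom L f -> weak_diff_op a f (L f)).

End on_domain.
End differential_operators.

(* Main.v *)
Require Import Defs.
From mathcomp Require Import all_boot all_order all_algebra.
From mathcomp Require Import complex.
From mathcomp Require Import all_classical all_reals all_analysis.
From mathcomp Require Import finmap measurable_realfun ring lra.

Set Implicit Arguments.
Unset Strict Implicit.
Unset Printing Implicit Defensive.

Import Order.TTheory GRing.Theory Num.Theory.
Import numFieldNormedType.Exports.

Local Open Scope classical_set_scope.
Local Open Scope ring_scope.

(** Let A be one of the operators L, L*, with eigenvectors e_i, A e_i = nu_i e_i,
    and let e'_i be the biorthogonal eigenvectors of the other operator.  Being
    Riesz bases, both systems are bounded and total; the weight is
    w_i = (1 + |nu_i|^2)^(1/(2m)), so that w_i^m and 1 + |nu_i| are comparable.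

    Decay of coefficients: moving A to the other side of the inner product gives
    (A^k f, e'_i) = nu_i^k (f, e'_i), and Cauchy-Schwarz bounds the left side by
    a multiple of ||A^k f||.  Hence w_i^k |(f, e'_i)| is at most a constant times
    the k-th graph norm of f: the transform takes values in the rapidly
    decreasing families and is continuous ([fourier_decay]).

    Synthesis: A^j maps sum_i h_i e_i to sum_i h_i nu_i^j e_i, and |nu_i|^j is at
    most w_i^(mj).  As some negative power of w is summable, the k-th graph norm of a
    finite sum is at most a single seminorm of h times a sum of summable weights
    ([sum_graph_norm]).  This one estimate makes the finite sums Cauchy, so that
    they have a limit in the smooth domain by completeness ([synthesis_exists]),
    and it makes the limit depend continuously on h ([synthesis_continuous]).
    Biorthogonality shows that the limit has coefficients h
    ([synthesis_fourier]); since the e'_i are total, coefficients determine the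
    vector ([fourier_inj]).  Therefore analysis and synthesis are mutually
    inverse homeomorphisms.

    Pointwise convergence: since |h_i u_i(x)| <= |h_i| (1 + |u_i(x)|^2) and the
    right side has a sum that is finite almost everywhere, the series converges
    absolutely at almost every x; the L^2 limit identifies its sum, by Fatou's
    lemma ([ae_expansion]).

    The argument is symmetric in the two operators, so that it is carried out
    once, for A, and used twice. *)

(** * The Hilbert space of square-integrable functions *)

Section inner_product.
Context d (T : measurableType d) (R : realType).
Variable mu : {measure set T -> \bar R}.
Local Notation H := (L2 mu).
Local Notation Re := complex.Re.
Local Notation Im := complex.Im.

Definition cmeasurable (F : T -> R[i]) : Prop :=
  measurable_fun setT (fun x => Re (F x)) /\ measurable_fun setT (fun x => Im (F x)).

Definition cintegrable (F : T -> R[i]) : Prop :=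
  mu.-integrable setT (fun x => (Re (F x))%:E) /\
  mu.-integrable setT (fun x => (Im (F x))%:E).

Lemma L2eval_sq (f : H) : L2eval f \in sq_integrable mu.
Proof. by rewrite /L2eval; case: (repr f). Qed.

Lemma L2eval_measurable (f : H) : cmeasurable (L2eval f).
Proof. by have /asboolP[] := L2eval_sq f. Qed.

Lemma cmeasurable_sq F : cmeasurable F ->
  measurable_fun setT (fun x => (cmod (F x) ^+ 2)%:E).
Proof.
move=> [mR mI]; apply/measurable_EFinP; under eq_fun do rewrite cmod_sq.
by apply: measurable_funD; exact: measurable_funX.
Qed.

Lemma L2eval_integrable_sq (f : H) :
  mu.-integrable setT (fun x => (cmod (L2eval f x) ^+ 2)%:E).
Proof.
have /asboolP[mR mI fi] := L2eval_sq f.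
apply/integrableP; split; first exact: cmeasurable_sq.
by under eq_integral do rewrite gee0_abs ?lee_fin ?sqr_ge0//.
Qed.

Lemma cmeasurableM F G : cmeasurable F -> cmeasurable G ->
  cmeasurable (fun x => F x * conjc (G x)).
Proof.
move=> [FR FI] [GR GI]; split.
  rewrite (_ : (fun x => _) = (fun x => Re (F x) * Re (G x) + Im (F x) * Im (G x))).
    by apply: measurable_funD; exact: measurable_funM.
  by apply/funext => x; case: (F x) (G x) => a b [c e] /=; rewrite mulrN opprK.
rewrite (_ : (fun x => _) = (fun x => Im (F x) * Re (G x) - Re (F x) * Im (G x))).
  by apply: measurable_funB; exact: measurable_funM.
by apply/funext => x; case: (F x) (G x) => a b [c e] /=; rewrite mulrN addrC.
Qed.

(** The real and imaginary parts of f * conj g are bounded by |f|^2 + |g|^2, so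
    that the inner product is an integral of an integrable function. *)
Lemma L2eval_mul_integrable (f g : H) :
  cintegrable (fun x => L2eval f x * conjc (L2eval g x)).
Proof.
have [mR mI] := cmeasurableM (L2eval_measurable f) (L2eval_measurable g).
have fgi := integrableD measurableT (L2eval_integrable_sq f) (L2eval_integrable_sq g).
have B x : `|Re (L2eval f x * conjc (L2eval g x))| <= cmod (L2eval f x) ^+ 2 + cmod (L2eval g x) ^+ 2
  /\ `|Im (L2eval f x * conjc (L2eval g x))| <= cmod (L2eval f x) ^+ 2 + cmod (L2eval g x) ^+ 2.
  rewrite !cmod_sq; case: (L2eval f x) (L2eval g x) => a b [c e] /=.
  have := sqr_ge0 (a - c); have := sqr_ge0 (a + c); have := sqr_ge0 (b - e).
  have := sqr_ge0 (b + e); have := sqr_ge0 (a - e); have := sqr_ge0 (a + e).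
  have := sqr_ge0 (b - c); have := sqr_ge0 (b + c).
  move=> *; split; rewrite ler_norml; apply/andP; split; nra.
split; (apply: le_integrable fgi; [by []|exact/measurable_EFinP|]) => x _;
  rewrite /= lee_fin [leRHS]ger0_norm ?addr_ge0 ?sqr_ge0//; by case: (B x).
Qed.

Lemma cintegralZD (a : R[i]) F G : cintegrable F -> cintegrable G ->
  cintegral mu (fun x => a * F x + G x) = a * cintegral mu F + cintegral mu G.
Proof.
case: a => p q [FR FI] [GR GI].
have Z (c : R) h : mu.-integrable setT (fun x => (h x)%:E) ->
  mu.-integrable setT (fun x => (c * h x)%:E).
  by move=> ih; under eq_fun do rewrite EFinM; exact: integrableZl.
have D h k : mu.-integrable setT (fun x => (h x)%:E) ->
  mu.-integrable setT (fun x => (k x)%:E) ->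
  mu.-integrable setT (fun x => (h x + k x)%:E).
  by move=> ih ik; under eq_fun do rewrite EFinD; exact: integrableD.
have -> : cintegral mu (fun x => Complex p q * F x + G x) = Complex
    (\int[mu]_x ((p * Re (F x) + (- q) * Im (F x)) + Re (G x)))
    (\int[mu]_x ((p * Im (F x) + q * Re (F x)) + Im (G x))).
  by congr Complex; apply: eq_Rintegral => x _;
    case: (F x) (G x) => ? ? [? ?] /=; rewrite ?mulNr.
rewrite !RintegralD//; try by do ?[apply: D|apply: Z].
by rewrite !RintegralZl// ?mulNr.
Qed.

Lemma cintegral_ae F G : cmeasurable F -> cmeasurable G ->
  {ae mu, forall x, F x = G x} -> cintegral mu F = cintegral mu G.
Proof.
move=> [FR FI] [GR GI] FG; rewrite /cintegral; congr Complex.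
  congr fine; apply: ae_eq_integral => //; try exact/measurable_EFinP.
  by apply: filterS FG => x -> _.
congr fine; apply: ae_eq_integral => //; try exact/measurable_EFinP.
by apply: filterS FG => x -> _.
Qed.

(** Passing to the class and back to a representative changes a function on a
    null set only; this is why identities between values of classes hold almost
    everywhere. *)
Lemma L2eval_pi (F : L2fun mu) :
  {ae mu, forall x, L2eval (\pi_(H)%qT F) x = F x}.
Proof.
have : (repr (\pi_(H)%qT F) - F) \in @ae_null _ _ _ mu.
  by rewrite Quotient.idealrBE reprK.
move=> /asboolP; apply: filterS => x /eqP.
by rewrite -[X in X == _]/(L2fun_val _ x - F x) subr_eq0 => /eqP.
Qed.

Lemma L2eval_lin (a : R[i]) (f g : H) :
  {ae mu, forall x, L2eval (a *: f + g) x = a * L2eval f x + L2eval g x}.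
Proof.
have -> : a *: f + g = \pi_(H)%qT (a *: repr f + repr g).
  rewrite -[f in LHS]reprK -[g in LHS]reprK.
  rewrite [in RHS]pi_addr; congr (_ + _).
  rewrite /GRing.scale /=.
  apply/eqP; rewrite -Quotient.idealrBE -scalerBr; apply: rpredZ.
  by rewrite Quotient.idealrBE !reprK.
exact: L2eval_pi.
Qed.

Lemma L2eval0 : {ae mu, forall x, L2eval (0 : H) x = 0}.
Proof.
have := L2eval_lin (-1) 0 0; apply: filterS => x.
by rewrite scaler0 addr0 mulN1r addNr.
Qed.

Lemma L2innerDl (a : R[i]) (f g h : H) :
  L2inner (a *: f + g) h = a * L2inner f h + L2inner g h.
Proof.
rewrite -cintegralZD; try exact: L2eval_mul_integrable.
apply: cintegral_ae.
- by apply: cmeasurableM; exact: L2eval_measurable.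
- rewrite (_ : (fun x => _) = fun x => (a * L2eval f x + L2eval g x) * conjc (L2eval h x)).
    apply: cmeasurableM; last exact: L2eval_measurable.
    have [fR fI] := L2eval_measurable f; have [gR gI] := L2eval_measurable g.
    split.
      rewrite (_ : (fun x => _) =
        fun x => (Re a * Re (L2eval f x) - Im a * Im (L2eval f x)) + Re (L2eval g x)).
        apply: measurable_funD => //.
        by apply: measurable_funB => //; apply: measurable_funM => //; exact: measurable_cst.
      by apply/funext => x; case: a (L2eval f x) (L2eval g x) => ? ? [? ?] [].
    rewrite (_ : (fun x => _) =
        fun x => (Re a * Im (L2eval f x) + Im a * Re (L2eval f x)) + Im (L2eval g x)).
      apply: measurable_funD => //.
      by apply: measurable_funD => //; apply: measurable_funM => //; exact: measurable_cst.
    by apply/funext => x; case: a (L2eval f x) (L2eval g x) => ? ? [? ?] [].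
  by apply/funext => x; rewrite mulrDl mulrA.
- by have := L2eval_lin a f g; apply: filterS => x ->; rewrite mulrDl mulrA.
Qed.

Lemma L2innerC (f g : H) : L2inner f g = conjc (L2inner g f).
Proof.
have [iR iI] := L2eval_mul_integrable g f.
rewrite /L2inner /cintegral /=; congr Complex.
  by apply: eq_Rintegral => x _; case: (L2eval f x) (L2eval g x) => a b [c e] /=; ring.
rewrite -mulN1r -RintegralZl//.
by apply: eq_Rintegral => x _; case: (L2eval f x) (L2eval g x) => a b [c e] /=; ring.
Qed.

Lemma L2inner_diag (f : H) : L2inner f f = Complex (L2norm f ^+ 2) 0.
Proof.
rewrite /L2inner /cintegral /L2norm sqr_sqrtr; last first.
  by apply: Rintegral_ge0 => x _; rewrite sqr_ge0.
congr Complex.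
  by apply: eq_Rintegral => x _; rewrite cmod_sq; case: (L2eval f x) => a b /=; ring.
rewrite (@eq_Rintegral _ _ _ _ _ (fun=> 0)) ?Rintegral_cst ?mul0r// => x _.
by case: (L2eval f x) => a b /=; ring.
Qed.

Lemma L2norm_ge0 (f : H) : 0 <= L2norm f.
Proof. exact: sqrtr_ge0. Qed.

Lemma L2norm_eq0 (f : H) : L2norm f = 0 -> f = 0.
Proof.
move=> f0.
have i0 : (\int[mu]_x (cmod (L2eval f x) ^+ 2)%:E = 0)%E.
  have := L2eval_integrable_sq f => /integrable_fin_num-/(_ measurableT) fi.
  rewrite -[LHS]fineK//; congr EFin.
  have : L2norm f ^+ 2 = 0 by rewrite f0 expr0n.
  by rewrite sqr_sqrtr// Rintegral_ge0// => x _; rewrite sqr_ge0.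
have := L2eval_measurable f => mf.
have /ae_eq_integral_abs : (\int[mu]_(x in setT) `|(cmod (L2eval f x) ^+ 2)%:E| = 0)%E.
  by rewrite -i0; apply: eq_integral => x _; rewrite gee0_abs// lee_fin sqr_ge0.
move=> /(_ measurableT (cmeasurable_sq mf)) ae0.
rewrite -[f]reprK -[RHS](reprK (0:H)); apply/eqP; rewrite -Quotient.idealrBE.
apply/asboolP; apply: filterS2 ae0 L2eval0 => x /(_ I) fx ox.
rewrite -[LHS]/(L2eval f x - L2eval (0 : H) x) ox subr0.
move: fx => -[] /eqP; rewrite expf_eq0 /= => /eqP.
exact: Normc.eq0_normc.
Qed.

Lemma L2inner0l (h : H) : L2inner 0 h = 0.
Proof.
have := L2innerDl (-1) (0 : H) 0 h.
by rewrite scaler0 addr0 mulN1r addNr.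
Qed.

Lemma L2innerD (f g h : H) : L2inner (f + g) h = L2inner f h + L2inner g h.
Proof. by have := L2innerDl 1 f g h; rewrite scale1r mul1r. Qed.

Lemma L2innerZ (a : R[i]) (f h : H) : L2inner (a *: f) h = a * L2inner f h.
Proof. by have := L2innerDl a f 0 h; rewrite L2inner0l !addr0. Qed.

Lemma L2innerB (f g h : H) : L2inner (f - g) h = L2inner f h - L2inner g h.
Proof. by rewrite -scaleN1r L2innerD L2innerZ mulN1r. Qed.

Lemma L2innerDr (f g h : H) : L2inner h (f + g) = L2inner h f + L2inner h g.
Proof.
by rewrite (L2innerC h) (L2innerC h f) (L2innerC h g) L2innerD rmorphD.
Qed.

Lemma L2innerZr (a : R[i]) (f h : H) : L2inner h (a *: f) = conjc a * L2inner h f.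
Proof. by rewrite (L2innerC h) (L2innerC h f) L2innerZ rmorphM. Qed.

Lemma cmod_ge0 (z : R[i]) : 0 <= cmod z.
Proof. by case: z => ? ?; exact: sqrtr_ge0. Qed.

(** Expanding the square of the norm of ||g||^2 f - (f, g) g gives
    ||g||^2 (||f||^2 ||g||^2 - |(f, g)|^2), which is therefore nonnegative. *)
Lemma L2_Cauchy_Schwarz (f g : H) : cmod (L2inner f g) <= L2norm f * L2norm g.
Proof.
have [g0|g0] := eqVneq (L2norm g) 0.
  by rewrite g0 mulr0 (L2norm_eq0 g0) L2innerC L2inner0l /= oppr0 expr0n /= addr0 sqrtr0.
have gp : 0 < L2norm g by rewrite lt_neqAle eq_sym g0 L2norm_ge0.
rewrite -ler_sqr ?nnegrE ?cmod_ge0 ?mulr_ge0 ?L2norm_ge0//.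
have := L2inner_diag (Complex (L2norm g ^+ 2) 0 *: f + (- L2inner f g) *: g).
rewrite L2innerD !L2innerDr !L2innerZ !L2innerZr !L2inner_diag.
rewrite [L2inner g f]L2innerC cmod_sq exprMn.
move: (sqr_ge0 (L2norm (Complex (L2norm g ^+ 2) 0 *: f + - L2inner f g *: g))).
case: (L2inner f g) => a b /=.
set N := _ ^+ 2; move: N => N N0 [] EN _.
move: EN; set F := L2norm f ^+ 2; have : 0 < L2norm g ^+ 2 by rewrite exprn_gt0.
move: (L2norm g ^+ 2) F => G F Gp EN.
have : 0 <= G * (F * G - (a ^+ 2 + b ^+ 2)).
  by move: N0; rewrite -EN; congr (0 <= _); ring.
by rewrite pmulr_rge0// subr_ge0.
Qed.

Lemma L2normZ (a : R[i]) (f : H) : L2norm (a *: f) = cmod a * L2norm f.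
Proof.
have ca := cmod_ge0 a.
apply/eqP; rewrite -(@eqrXn2 _ 2) ?nnegrE ?mulr_ge0 ?L2norm_ge0//; apply/eqP.
have := L2inner_diag (a *: f); rewrite L2innerZ L2innerZr L2inner_diag.
rewrite exprMn cmod_sq; case: (a) => p q /= [] <- _; ring.
Qed.

Lemma L2normD (f g : H) : L2norm (f + g) <= L2norm f + L2norm g.
Proof.
rewrite -ler_sqr ?nnegrE ?addr_ge0 ?L2norm_ge0//.
have := L2inner_diag (f + g); rewrite L2innerD !L2innerDr !L2inner_diag.
rewrite [L2inner g f]L2innerC.
have := L2_Cauchy_Schwarz f g.
case: (L2inner f g) => a b /= CS [] <- _.
have : a <= Num.sqrt (a ^+ 2 + b ^+ 2).
  apply: le_trans (ler_norm _) _; rewrite -sqrtr_sqr; apply: ler_wsqrtr.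
  by rewrite lerDl sqr_ge0.
move=> /le_trans/(_ CS); rewrite sqrrD; lra.
Qed.

Lemma L2norm0 : L2norm (0 : H) = 0.
Proof. by rewrite -(scale0r (0 : H)) L2normZ Normc.normc0 mul0r. Qed.

Lemma L2normN (f : H) : L2norm (- f) = L2norm f.
Proof. by rewrite -scaleN1r L2normZ normcN Normc.normc1 mul1r. Qed.

Lemma L2norm_sum (J : Type) (s : seq J) (P : pred J) (F : J -> H) :
  L2norm (\sum_(i <- s | P i) F i) <= \sum_(i <- s | P i) L2norm (F i).
Proof.
elim/big_rec2 : _ => [|i x y _ le]; first by rewrite L2norm0.
by apply: le_trans (L2normD _ _) _; rewrite lerD2l.
Qed.

Lemma L2eval_sum (J : Type) (s : seq J) (h : J -> R[i]) (F : J -> H) :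
  {ae mu, forall x,
    L2eval (\sum_(i <- s) h i *: F i) x = \sum_(i <- s) h i * L2eval (F i) x}.
Proof.
elim: s => [|i s IH].
  by have := L2eval0; apply: filterS => x; rewrite !big_nil.
have := L2eval_lin (h i) (F i) (\sum_(i <- s) h i *: F i).
by apply: filterS2 IH => x IH; rewrite !big_cons => ->; rewrite IH.
Qed.

End inner_product.

(** * Topologies defined by countably many gauges *)

Section gauge_topology.
Context {R : realType} {T : choiceType} (p : nat -> T -> T -> R).

Lemma gauge_ball_open k (f : T) (e : R) : 0 < e ->
  open ([set g | p k f g < e] : set (gauge_space p)).
Proof.
move=> e0; exists [set [set g | p k f g < e]]; last first.
  by rewrite predeqE => g; split=> [[_ ->]|] //; exists [set g | p k f g < e].
move=> _ ->; exists [fset [set g | p k f g < e]]%fset.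
  have B : gauge_balls p [set g | p k f g < e] by exists k, f, e.
  by move=> A; rewrite inE => /eqP ->; exact: (mem_set B).
rewrite predeqE => g; split=> [H|H A]; last by rewrite /= inE => /eqP ->.
by apply: (H [set g | p k f g < e]); rewrite /= inE.
Qed.

(** Neighbourhoods are finite intersections of balls that contain the limit f
    but need not be centred at f: each such ball has to be tested. *)
Lemma gauge_cvg (F : set_system T) (f : gauge_space p) : Filter F ->
  (forall k g e, p k g f < e -> F [set h | p k g h < e]) -> F --> f.
Proof.
move=> FF cvF A; rewrite nbhsE => -[_ [[B sB <-] [C BC Cf]] sBA].
apply: filterS sBA _; apply: (@filterS _ _ _ C); first by move=> ? ?; exists C.
have /sB [D sD IDeC] := BC; rewrite -IDeC; apply: filter_bigI => E DE.
have /sD/set_mem := DE => -[k [g [e [e0 EE]]]].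
by rewrite EE; apply: cvF; move: Cf; rewrite -IDeC => /(_ _ DE); rewrite EE.
Qed.

End gauge_topology.

(** The triangle inequality for q reduces the balls with an arbitrary centre,
    which generate the topology, to balls centred at the image point. *)
Lemma gauge_continuous (R : realType) (T U : choiceType)
    (p : nat -> T -> T -> R) (q : nat -> U -> U -> R) (F : T -> U) :
  (forall k f, p k f f = 0) ->
  (forall k f g h, q k f h <= q k f g + q k g h) ->
  (forall k, exists j (C : R), 0 <= C /\ forall f g, q k (F f) (F g) <= C * p j f g) ->
  continuous (F : gauge_space p -> gauge_space q).
Proof.
move=> p0 qD qp f.
have NF : Filter (nbhs (f : gauge_space p)) by exact: nbhs_filter.
apply: gauge_cvg => k g e fe.
have [j [C [C0 Cp]]] := qp k.
pose r := (e - q k g (F f)) / (C + 1).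
have r0 : 0 < r by rewrite divr_gt0 ?subr_gt0// ltr_wpDl.
have N : nbhs (f : gauge_space p) [set h | p j f h < r].
  by apply: open_nbhs_nbhs; split; [exact: gauge_ball_open|rewrite /= p0].
apply: filterS N => h /= fh; apply: (le_lt_trans (qD k g (F f) (F h))).
rewrite -ltrBrDl; apply: (le_lt_trans (Cp f h)).
apply: (@le_lt_trans _ _ (C * r)); first by rewrite ler_wpM2l// ltW.
rewrite /r mulrCA gtr_pMr ?subr_gt0//.
by rewrite ltr_pdivrMr ?mul1r ?ltrDl// ltr_wpDl.
Qed.

(** * Sums over finite sets of indices *)

Section finite_sums.
Context {R : realType} {I : choiceType}.
Implicit Types (s t : {fset I}).

Lemma sum_fsetD (V : zmodType) (F : I -> V) s t : (s `<=` t)%fset ->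
  \sum_(i <- t) F i = \sum_(i <- s) F i + \sum_(i <- (t `\` s)%fset) F i.
Proof.
move=> st; rewrite -big_cat; apply: perm_big; apply: uniq_perm => //.
  rewrite cat_uniq !fset_uniq /= andbT; apply/hasPn => i.
  by rewrite in_fsetD => /andP[].
move=> i; rewrite mem_cat in_fsetD.
by case: (boolP (i \in s)) => [/(fsubsetP st)->|].
Qed.

Lemma fset_sum_le (c : I -> R) s t : (forall i, 0 <= c i) -> (s `<=` t)%fset ->
  \sum_(i <- s) c i <= \sum_(i <- t) c i.
Proof. by move=> c0 /(sum_fsetD c) ->; rewrite lerDl sumr_ge0. Qed.

(** Summability is expressed through finite partial sums, as the expansions below
    are limits over the directed set of finite sets of indices. *)
Definition summable_weight (c : I -> R) : Prop :=
  (forall i, 0 <= c i) /\ exists M, forall s, \sum_(i <- s) c i <= M.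

Lemma esum_summable (c : I -> R) : (forall i, 0 <= c i) ->
  (\esum_(i in [set: I]) (c i)%:E < +oo)%E -> summable_weight c.
Proof.
move=> c0 coo; split => //.
have cfin : (\esum_(i in [set: I]) (c i)%:E)%E \is a fin_num.
  by rewrite ge0_fin_numE// esum_ge0// => i _; rewrite lee_fin.
exists (fine (\esum_(i in [set: I]) (c i)%:E)%E) => s.
rewrite -lee_fin fineK// -sumEFin; apply: esum_ge.
exists [set` s]; first by split.
by rewrite fsbig_finite//= set_fsetK.
Qed.

(** A finite set whose sum is within e of the supremum of all finite sums leaves
    less than e to any finite set that is disjoint from it. *)
Lemma summable_tail (c : I -> R) (e : R) : summable_weight c -> 0 < e ->
  exists s, forall t, [disjoint s & t]%fset -> \sum_(i <- t) c i < e.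
Proof.
move=> [c0 [M cM]] e0.
pose A := [set x | exists s, x = \sum_(i <- s) c i].
have hA : has_sup A.
  split; first by exists (\sum_(i <- fset0) c i), fset0.
  by exists M => _ [s ->].
have [_ [s ->] sA] := sup_adherent e0 hA.
exists s => t st; rewrite -(ltrD2l (\sum_(i <- s) c i)).
apply: (@le_lt_trans _ _ (sup A)); last by rewrite -ltrBlDr.
have -> : \sum_(i <- s) c i + \sum_(i <- t) c i = \sum_(i <- (s `|` t)%fset) c i.
  rewrite (@sum_fsetD _ _ s (s `|` t)%fset) ?fsubsetUl//; congr (_ + _).
  congr (\sum_(i <- enum_fset _) _); apply/fsetP => i; rewrite in_fsetD in_fsetU.
  case: (boolP (i \in s)) => //= si; apply/negbTE.
  by move/fdisjointP: st; exact.
by apply: ub_le_sup; [exact: hA.2|exists (s `|` t)%fset].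
Qed.

End finite_sums.

(** Completeness and Fatou's lemma are about sequences, while the expansions are
    limits over finite sets of indices; an increasing cofinal sequence of finite
    sets links the two. *)
Lemma fset_exhaustion (I : choiceType) : countable [set: I] ->
  exists A : nat -> {fset I},
    (forall n k, (n <= k)%N -> (A n `<=` A k)%fset) /\
    (forall s : {fset I}, exists n, (s `<=` A n)%fset).
Proof.
move=> /countable_injP[f finj].
pose B n : set I := f @^-1` `I_n.
have fB n : finite_set (B n).
  by apply: finite_preimage; [move=> x y _ _; apply: finj; exact: mem_set|exact: finite_II].
have BE n i : (i \in fset_set (B n)) = (f i < n)%N.
  by rewrite in_fset_set//; apply/idP/idP => [/set_mem//|fi]; exact/mem_set.
exists (fun n => fset_set (B n)); split=> [n k nk|s].
  by apply/fsubsetP => i; rewrite !BE => /leq_trans; exact.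
exists (\max_(i <- s) f i).+1; apply/fsubsetP => i si; rewrite BE ltnS.
exact: (leq_bigmax_seq _ si isT).
Qed.

(** * Consequences of Fatou's lemma *)

Lemma limn_einf_lt (R : realType) (x : nat -> R) (e : R) (N : nat) :
  (limn_einf (fun n => (x n)%:E) < e%:E)%E -> exists2 n, (N <= n)%N & x n < e.
Proof.
move=> xe; apply: contrapT => H.
suff : (e%:E <= limn_einf (fun n => (x n)%:E))%E by rewrite leNgt xe.
rewrite limn_einf_lim; apply: lime_ge; first exact: is_cvg_einfs.
exists N => // n /= Nn; apply: le_ereal_inf_tmp => _ [k /= nk <-].
rewrite lee_fin leNgt; apply/negP => ke; apply: H.
by exists k => //; exact: leq_trans nk.
Qed.

Section fatou_consequences.
Context d (T : measurableType d) (R : realType).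
Variables (mu : {measure set T -> \bar R}) (F : nat -> T -> R).
Hypothesis mF : forall n, measurable_fun setT (F n).
Hypothesis F0 : forall n x, 0 <= F n x.

Let mFE n : measurable_fun setT (fun x => (F n x)%:E).
Proof. exact/measurable_EFinP. Qed.

Let mliminf : measurable_fun setT (fun x => limn_einf (fun n => (F n x)%:E)).
Proof.
rewrite (_ : (fun x => _) = fun x => - limn_esup (fun n => - (F n x)%:E))%E.
  apply: measurableT_comp => //; apply: measurable_fun_limn_esup => n.
  exact: measurableT_comp.
apply/funext => x; rewrite -limn_einfN; congr limn_einf.
by apply/funext => n; rewrite /comp oppeK.
Qed.

Let liminf0 x : (0 <= limn_einf (fun n => (F n x)%:E))%E.
Proof.
rewrite limn_einf_lim; apply: lime_ge; first exact: is_cvg_einfs.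
by exists 0%N => // n _; apply: le_ereal_inf_tmp => _ [k _ <-]; rewrite lee_fin.
Qed.

Let F0E n x : [set: T] x -> (0 <= (F n x)%:E)%E.
Proof. by rewrite lee_fin. Qed.

(** By Fatou's lemma the lower limit of F has an integral of at most M, so that
    it is finite almost everywhere.  For the nondecreasing sequences to which
    this is applied, it says that they are bounded almost everywhere. *)
Lemma ae_frequently_bounded (M : R) :
  (forall n, \int[mu]_x (F n x)%:E <= M%:E)%E ->
  {ae mu, forall x, exists B, forall N, exists2 n, (N <= n)%N & F n x <= B}.
Proof.
move=> FM.
have i : mu.-integrable setT (fun x => limn_einf (fun n => (F n x)%:E)).
  apply/integrableP; split => //.
  under eq_integral do rewrite gee0_abs//.
  apply: (le_lt_trans (fatou mu measurableT mFE F0E)).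
  apply: (@le_lt_trans _ _ M%:E); last exact: ltry.
  rewrite limn_einf_lim; apply: lime_le; first exact: is_cvg_einfs.
  exists 0%N => // n _; apply: le_trans (FM n); apply: ereal_inf_lbound.
  by exists n => /=.
have := integrable_ae measurableT i; apply: filterS => x /(_ I) xfin.
exists (fine (limn_einf (fun n => (F n x)%:E)) + 1) => N.
have [|n Nn nx] := @limn_einf_lt R (F^~ x) (fine (limn_einf (fun n => (F n x)%:E)) + 1) N.
  by rewrite EFinD fineK// lteDl// lte_fin.
by exists n => //; exact: ltW.
Qed.

(** By Fatou's lemma the lower limit of F has integral 0, so that it vanishes
    almost everywhere.  Smallness of F n x for arbitrarily large n suffices to
    identify a limit that is already known to exist. *)
Lemma ae_frequently_small :
  (fun n => \int[mu]_x (F n x)%:E)%E @ \oo --> (0%E : \bar R) ->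
  {ae mu, forall x, forall e, 0 < e -> forall N, exists2 n, (N <= n)%N & F n x < e}.
Proof.
move=> Fc.
have : (\int[mu]_(x in setT) `|limn_einf (fun n => (F n x)%:E)| = 0)%E.
  under eq_integral do rewrite gee0_abs//.
  apply/eqP; rewrite eq_le integral_ge0// andbT.
  by apply: (le_trans (fatou mu measurableT mFE F0E)); rewrite (cvg_limn_einf_sup Fc).1.
move=> /ae_eq_integral_abs -/(_ measurableT mliminf).
apply: filterS => x /(_ I) x0 e e0 N.
by apply: limn_einf_lt; rewrite x0 lte_fin.
Qed.

End fatou_consequences.

(** * Almost everywhere convergence of expansions *)

Lemma totally_cvg0 (R : realType) (I : choiceType) (phi : {fset I} -> R) :
  (forall s, 0 <= phi s) ->
  (forall e, 0 < e -> exists s0, forall s, (s0 `<=` s)%fset -> phi s < e) ->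
  phi s @[s --> @summability.totally I] --> (0 : R).
Proof.
move=> phi0 H.
have FF := @summability.totally_filter I.
apply/cvgrPdist_lt => e e0; have [s0 s0P] := H e e0.
exists s0 => // s /= s0s; rewrite sub0r normrN ger0_norm//; exact: s0P.
Qed.

Section ae_convergence.
Context d (T : measurableType d) (R : realType).
Variable mu : {measure set T -> \bar R}.
Local Notation H := (L2 mu).
Variable I : choiceType.

Lemma cmod_sum (J : Type) (s : seq J) (P : pred J) (F : J -> R[i]) :
  cmod (\sum_(i <- s | P i) F i) <= \sum_(i <- s | P i) cmod (F i).
Proof.
elim/big_rec2 : _ => [|i x y _ le]; first by rewrite Normc.normc0.
by apply: le_trans (le_normcD _ _) _; rewrite lerD2l.
Qed.

Lemma complex_sum_tail (z : I -> R[i]) (e : R) :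
  summable_weight (fun i => cmod (z i)) -> 0 < e ->
  exists s0 : {fset I}, forall s : {fset I}, (s0 `<=` s)%fset ->
    cmod (\sum_(i <- s) z i - \sum_(i <- s0) z i) < e.
Proof.
move=> zs e0; have [s0 s0P] := summable_tail zs e0.
exists s0 => s s0s; rewrite (sum_fsetD z s0s) addrAC subrr add0r.
apply: (le_lt_trans (cmod_sum _ _ _)); apply: s0P.
by apply/fdisjointP => i is0; rewrite in_fsetD is0.
Qed.

Lemma L2norm_sqE (f : H) :
  (\int[mu]_x (cmod (L2eval f x) ^+ 2)%:E = (L2norm f ^+ 2)%:E)%E.
Proof.
rewrite sqr_sqrtr; last by apply: Rintegral_ge0 => x _; rewrite sqr_ge0.
by rewrite fineK//; apply: integrable_fin_num => //; exact: L2eval_integrable_sq.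
Qed.

Lemma measurable_cmod_sq (f : H) :
  measurable_fun setT (fun x => cmod (L2eval f x) ^+ 2).
Proof. by apply/measurable_EFinP/cmeasurable_sq; exact: L2eval_measurable. Qed.

(** Integrating sum_i |h_i| |u_i|^2 term by term shows that it is finite almost
    everywhere; then so is sum_i |h_i u_i|, because q <= 1 + q^2.  Hence the
    partial sums have small tails at almost every point.  Along an exhausting
    sequence of finite sets they come close to f infinitely often, by the
    convergence in L^2; with small tails, this forces the whole net to converge
    to f. *)
Lemma ae_expansion (u : I -> H) (h : I -> R[i]) (f : H) (b : R) :
  countable [set: I] ->
  (forall i, L2norm (u i) <= b) ->
  summable_weight (fun i => cmod (h i)) ->
  (forall e, 0 < e -> exists s0 : {fset I}, forall s : {fset I},
     (s0 `<=` s)%fset -> L2norm (\sum_(i <- s) h i *: u i - f) < e) ->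
  {ae mu, forall x, cmod (\sum_(i <- s) h i * L2eval (u i) x - L2eval f x)
     @[s --> @summability.totally I] --> (0 : R)}.
Proof.
move=> cI ub hs hf.
have [A [Amono Acover]] := fset_exhaustion cI.
have [h0 [M hM]] := hs.
pose F n x : R := \sum_(i <- A n) cmod (h i) * cmod (L2eval (u i) x) ^+ 2.
have aeF : {ae mu, forall x, exists B, forall N, exists2 n, (N <= n)%N & F n x <= B}.
  apply: (@ae_frequently_bounded _ _ _ mu F _ _ (M * b ^+ 2)).
  - move=> n; apply: measurable_sum => i.
    by apply: measurable_funM; [exact: measurable_cst|exact: measurable_cmod_sq].
  - by move=> n x; apply: sumr_ge0 => i _; rewrite mulr_ge0 ?cmod_ge0// sqr_ge0.
  move=> n; rewrite /F; under eq_integral do rewrite -sumEFin.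
  rewrite ge0_integral_sum//; last 2 first.
  - move=> i; apply/measurable_EFinP.
    by apply: measurable_funM; [exact: measurable_cst|exact: measurable_cmod_sq].
  - by move=> i x _; rewrite lee_fin mulr_ge0 ?cmod_ge0// sqr_ge0.
  rewrite (eq_bigr (fun i => (cmod (h i) * L2norm (u i) ^+ 2)%:E)); last first.
    move=> i _; under eq_integral do rewrite EFinM.
    rewrite ge0_integralZl ?lee_fin ?cmod_ge0//.
    - by rewrite L2norm_sqE.
    - by apply/measurable_EFinP; exact: measurable_cmod_sq.
    - by move=> x _; rewrite lee_fin sqr_ge0.
  rewrite sumEFin lee_fin.
  apply: (@le_trans _ _ (\sum_(i <- A n) cmod (h i) * b ^+ 2)).
    apply: ler_sum => i _; rewrite ler_wpM2l ?cmod_ge0//.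
    by rewrite lerXn2r ?nnegrE ?L2norm_ge0// (le_trans (L2norm_ge0 (u i))).
  by rewrite -mulr_suml ler_wpM2r ?sqr_ge0.
pose S n := \sum_(i <- A n) h i *: u i.
have aeS : {ae mu, forall x, forall e, 0 < e -> forall N,
    exists2 n, (N <= n)%N & cmod (L2eval (S n - f) x) ^+ 2 < e}.
  apply: (@ae_frequently_small _ _ _ mu (fun n x => cmod (L2eval (S n - f) x) ^+ 2)).
  - by move=> n; exact: measurable_cmod_sq.
  - by move=> n x; exact: sqr_ge0.
  under eq_fun do rewrite L2norm_sqE.
  apply/fine_cvgP; split; first by exists 0%N.
  apply/cvgrPdist_lt => e e0.
  have se : 0 < Num.sqrt e by rewrite sqrtr_gt0.
  have [s0 s0P] := hf (Num.sqrt e) se.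
  have [N s0N] := Acover s0.
  exists N => // n /= Nn.
  rewrite sub0r normrN ger0_norm ?sqr_ge0//.
  rewrite /= -(sqr_sqrtr (ltW e0)) ltr_sqr ?nnegrE ?sqrtr_ge0 ?L2norm_ge0//.
  exact: s0P _ (fsubset_trans s0N (Amono _ _ Nn)).
have aeE : {ae mu, forall x, forall n,
    L2eval (S n - f) x = \sum_(i <- A n) h i * L2eval (u i) x - L2eval f x}.
  apply: ae_foralln => n.
  have E1 := L2eval_sum (A n) h u; have E2 := L2eval_lin (-1) f (S n).
  apply: filterS2 E1 E2 => x <-.
  by rewrite scaleN1r mulN1r [in X in X -> _]addrC => ->; rewrite addrC.
apply: filterS3 aeF aeS aeE => x [B FB] Sx SE.
pose z i := h i * L2eval (u i) x.
have zs : summable_weight (fun i => cmod (z i)).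
  split=> [i|]; first exact: cmod_ge0.
  exists (M + B) => s; have [N sN] := Acover s.
  have [n Nn Fn] := FB N.
  apply: (le_trans (fset_sum_le _ (fsubset_trans sN (Amono _ _ Nn)))).
    by move=> i; exact: cmod_ge0.
  apply: (@le_trans _ _ (\sum_(i <- A n) (cmod (h i) + cmod (h i) * cmod (L2eval (u i) x) ^+ 2))).
    apply: ler_sum => i _; rewrite /z Normc.normcM.
    have := cmod_ge0 (h i); move: (cmod (h i)) (cmod (L2eval _ _)) => p q p0.
    have q1 : 0 <= q ^+ 2 - q + 1 by have := sqr_ge0 (q - 1); have := sqr_ge0 q; nra.
    by have := mulr_ge0 p0 q1; nra.
  by rewrite big_split lerD.
apply: totally_cvg0 => [s|e e0]; first exact: cmod_ge0.
(* The partial sum over s is compared with the one over s0, the latter with the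
   one over some A n that contains s0, and the last one with f. *)
have e3 : 0 < e / 3 by rewrite divr_gt0.
have [s0 s0P] := complex_sum_tail zs e3.
exists s0 => s s0s.
have [N s0N] := Acover s0.
have [|n Nn] := Sx ((e / 3) ^+ 2) _ N; first by rewrite exprn_gt0.
rewrite ltr_sqr ?nnegrE ?cmod_ge0 ?(ltW e3)// SE => Sn.
have hs1 := s0P s s0s.
have hs2 := s0P _ (fsubset_trans s0N (Amono _ _ Nn)).
rewrite -normcN opprB in hs2.
rewrite -/(z _).
have -> : \sum_(i <- s) h i * L2eval (u i) x - L2eval f x =
  (\sum_(i <- s) z i - \sum_(i <- s0) z i) +
  ((\sum_(i <- s0) z i - \sum_(i <- A n) z i) +
   (\sum_(i <- A n) z i - L2eval f x)).
  by rewrite [X in _ = _ + X]addrA subrK addrA subrK.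
apply: (le_lt_trans (le_normcD _ _)).
have := le_normcD (\sum_(i <- s0) z i - \sum_(i <- A n) z i) (\sum_(i <- A n) z i - L2eval f x).
move: Sn hs1 hs2; rewrite -/z; move: (cmod _) (cmod _) (cmod _) (cmod _) => p q r t.
lra.
Qed.

End ae_convergence.

(** * Rapidly decreasing families *)

Section rapidly_decreasing_sequences.
Context {R : realType} {I : choiceType} (w : I -> R).
Hypothesis w1 : forall i, 1 <= w i.

Let w0 i : 0 <= w i. Proof. by rewrite (le_trans _ (w1 i)). Qed.

Lemma weight_expn_ge1 k i : 1 <= w i ^+ k.
Proof. exact: exprn_ege1. Qed.

(** As w >= 1, a real exponent may be replaced by a larger integer, so that the
    seminorms with integer exponents describe rapid decrease. *)
Lemma rapidly_decreasingP (phi : I -> R[i]) :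
  rapidly_decreasing w phi <->
  forall k : nat, exists C : R, forall i, w i ^+ k * cmod (phi i) <= C.
Proof.
split=> [H k|H M].
  have [C CP] := H k%:R; exists C => i.
  have wk : 0 < w i ^+ k by rewrite (lt_le_trans _ (weight_expn_ge1 k i)).
  have := CP i; rewrite powRN powR_mulrn// => /(ler_wpM2l (ltW wk)).
  by rewrite mulrCA mulfV ?mulr1// gt_eqF.
have [k Mk] : exists k : nat, M <= k%:R.
  exists (Num.truncn M).+1; exact/ltW/truncnS_gt.
have [C CP] := H k; exists C => i.
have wk : 0 < w i ^+ k by rewrite (lt_le_trans _ (weight_expn_ge1 k i)).
have C0 : 0 <= C by apply: le_trans (CP i); rewrite mulr_ge0 ?cmod_ge0// ltW.
have : cmod (phi i) <= C * (w i ^+ k)^-1 by rewrite ler_pdivlMr// mulrC.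
move=> /le_trans; apply; rewrite ler_wpM2l//.
rewrite -powR_mulrn// -powRN ler_powR//.
by rewrite lerN2.
Qed.

Lemma rapidly_decreasingB (phi psi : I -> R[i]) :
  rapidly_decreasing w phi -> rapidly_decreasing w psi ->
  rapidly_decreasing w (phi - psi).
Proof.
move=> /rapidly_decreasingP H1 /rapidly_decreasingP H2.
apply/rapidly_decreasingP => k; have [C1 P1] := H1 k; have [C2 P2] := H2 k.
exists (C1 + C2) => i; apply: le_trans (lerD (P1 i) (P2 i)).
rewrite -mulrDr ler_wpM2l ?exprn_ge0//.
by apply: le_trans (le_normcD _ _) _; rewrite normcN.
Qed.

Lemma schwartz_norm_ge k phi i : rapidly_decreasing w phi ->
  w i ^+ k * cmod (phi i) <= schwartz_norm w k phi.
Proof.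
move=> /rapidly_decreasingP/(_ k)[C CP]; apply: ub_le_sup; last by exists i.
by exists C => _ [j _ <-].
Qed.

(** The bound C >= 0 covers an empty index set, on which the supremum is 0. *)
Lemma schwartz_norm_le k phi (C : R) : 0 <= C ->
  (forall i, w i ^+ k * cmod (phi i) <= C) -> schwartz_norm w k phi <= C.
Proof.
move=> C0 CP; rewrite /schwartz_norm.
set A := [set _ | _ in _]; have [->|/set0P A0] := eqVneq A set0.
  by rewrite sup0.
by apply: ge_sup => // _ [i _ <-].
Qed.

Lemma schwartz_norm_ge0 k phi : rapidly_decreasing w phi ->
  0 <= schwartz_norm w k phi.
Proof.
move=> rphi; rewrite /schwartz_norm.
set A := [set _ | _ in _]; have [->|/set0P[_ [i _ _]]] := eqVneq A set0.
  by rewrite sup0.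
apply: le_trans (schwartz_norm_ge k i rphi).
by rewrite mulr_ge0 ?cmod_ge0// exprn_ge0.
Qed.

Lemma schwartz_norm0 k : schwartz_norm w k 0 = 0.
Proof.
have r0 : rapidly_decreasing w 0.
  by apply/rapidly_decreasingP => j; exists 0 => i; rewrite Normc.normc0 mulr0.
apply/eqP; rewrite eq_le schwartz_norm_ge0// andbT.
by apply: schwartz_norm_le => // i; rewrite Normc.normc0 mulr0.
Qed.

Lemma schwartz_normD k phi psi :
  rapidly_decreasing w phi -> rapidly_decreasing w psi ->
  schwartz_norm w k (phi + psi) <= schwartz_norm w k phi + schwartz_norm w k psi.
Proof.
move=> rphi rpsi.
apply: schwartz_norm_le => [|i]; first by rewrite addr_ge0 ?schwartz_norm_ge0.
apply: le_trans (lerD (schwartz_norm_ge k i rphi) (schwartz_norm_ge k i rpsi)).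
by rewrite -mulrDr ler_wpM2l ?exprn_ge0//; exact: le_normcD.
Qed.

End rapidly_decreasing_sequences.

(** * Smooth vectors of an unbounded operator *)

Section graph_norms.
Context d (T : measurableType d) (R : realType).
Variable mu : {measure set T -> \bar R}.
Local Notation H := (L2 mu).
Variable A : operator H.

Lemma smooth_domP (f : H) : smooth_dom A f <-> forall j, dom A (iter j A f).
Proof.
split=> [sf j|sf k _ j _]; last exact: sf.
by apply: (sf j.+1).
Qed.

Lemma op0 : A 0 = 0.
Proof.
have [d0 _] := dom_linear A; have := op_linear (-1) d0 d0.
by rewrite scaler0 addr0 scaleN1r addNr.
Qed.

(** An operator is linear on its domain only.  All iterates of a smooth vector
    stay in the domain, so that on smooth vectors the iterates are linear. *)
Lemma smooth_iter_linear (a : R[i]) (f g : H) :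
  smooth_dom A f -> smooth_dom A g ->
  smooth_dom A (a *: f + g) /\
  forall j, iter j A (a *: f + g) = a *: iter j A f + iter j A g.
Proof.
move=> /smooth_domP sf /smooth_domP sg.
have E j : iter j A (a *: f + g) = a *: iter j A f + iter j A g.
  by elim: j => //= j ->; rewrite op_linear.
split=> //; apply/smooth_domP => j; rewrite E.
by have [_] := dom_linear A; apply.
Qed.

Lemma iter_op0 j : iter j A 0 = 0.
Proof. by elim: j => //= j ->; exact: op0. Qed.

Lemma smooth0 : smooth_dom A 0.
Proof.
by apply/smooth_domP => j; rewrite iter_op0; have [] := dom_linear A.
Qed.

Lemma smoothB (f g : H) :
  smooth_dom A f -> smooth_dom A g -> smooth_dom A (f - g).
Proof.
by move=> sf sg; have [] := smooth_iter_linear (-1) sg sf; rewrite scaleN1r addrC.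
Qed.

Lemma iter_opB j (f g : H) : smooth_dom A f -> smooth_dom A g ->
  iter j A (f - g) = iter j A f - iter j A g.
Proof.
move=> sf sg; have [_ /(_ j)] := smooth_iter_linear (-1) sg sf.
by rewrite !scaleN1r [X in iter _ _ X]addrC => ->; rewrite addrC.
Qed.

Lemma graph_norm_ge k j (f : H) : (j <= k)%N ->
  L2norm (iter j A f) <= graph_norm A k f.
Proof.
move=> jk; have jk1 : (j < k.+1)%N by [].
exact: (le_bigmax 0 (fun j : 'I_k.+1 => L2norm (iter j A f)) (Ordinal jk1)).
Qed.

Lemma graph_norm_le k (f : H) (C : R) : 0 <= C ->
  (forall j, (j <= k)%N -> L2norm (iter j A f) <= C) -> graph_norm A k f <= C.
Proof. by move=> C0 fC; apply: bigmax_le => // j _; apply: fC; case: j. Qed.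

Lemma graph_norm_ge0 k (f : H) : 0 <= graph_norm A k f.
Proof. by apply: le_trans (graph_norm_ge f (leq0n k)); exact: L2norm_ge0. Qed.

Lemma graph_normC k (f g : H) : smooth_dom A f -> smooth_dom A g ->
  graph_norm A k (f - g) = graph_norm A k (g - f).
Proof.
by move=> sf sg; apply: eq_bigr => j _; rewrite !iter_opB// -L2normN opprB.
Qed.

Lemma graph_norm_triangle k (f g h : H) :
  smooth_dom A f -> smooth_dom A g -> smooth_dom A h ->
  graph_norm A k (f - h) <= graph_norm A k (f - g) + graph_norm A k (g - h).
Proof.
move=> sf sg sh; apply: graph_norm_le => [|j jk].
  by rewrite addr_ge0 ?graph_norm_ge0.
apply: le_trans (lerD (graph_norm_ge _ jk) (graph_norm_ge _ jk)).
rewrite !iter_opB//; apply: le_trans (L2normD _ _).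
by rewrite addrA subrK.
Qed.

Lemma graph_norm0 k : graph_norm A k 0 = 0.
Proof.
apply/eqP; rewrite eq_le graph_norm_ge0 andbT.
by apply: graph_norm_le => // j _; rewrite iter_op0 L2norm0.
Qed.

End graph_norms.

(** * Expansion in eigenvectors *)

Section eigenfunction_expansion.
Context d (T : measurableType d) (R : realType).
Variable mu : {measure set T -> \bar R}.
Local Notation H := (L2 mu).
Variable I : choiceType.
Variables (A : operator H) (e e' : I -> H) (nu : I -> R[i]) (w c : I -> R).
Variables (b : R) (m N0 : nat).
Hypothesis cI : countable [set: I].
Hypothesis e_eigen : forall i, dom A (e i) /\ A (e i) = nu i *: e i.
Hypothesis e'_eigen : forall f i, dom A f ->
  L2inner (A f) (e' i) = nu i * L2inner f (e' i).
Hypothesis biorth : forall i j, L2inner (e i) (e' j) = (i == j)%:R.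
Hypothesis e_bounded : forall i, L2norm (e i) <= b.
Hypothesis e'_bounded : forall i, L2norm (e' i) <= b.
Hypothesis e'_total : forall f, (forall i, L2inner f (e' i) = 0) -> f = 0.
Hypothesis m1 : (1 <= m)%N.
Hypothesis b_ge0 : 0 <= b.
Hypothesis w1 : forall i, 1 <= w i.
Hypothesis nu_le : forall i, cmod (nu i) <= w i ^+ m.
Hypothesis w_le : forall i, w i ^+ m <= 1 + cmod (nu i).
(* Summability of a negative power of the weight, in the form of a summable
   family c with c_i >= w_i^(-N0). *)
Hypothesis c_summable : summable_weight c.
Hypothesis c_ge : forall i, 1 <= w i ^+ N0 * c i.
Hypothesis A_closed : closed_under_limits A.

Let w0 i : 0 <= w i. Proof. by rewrite (le_trans _ (w1 i)). Qed.
Let c0 i : 0 <= c i. Proof. by case: c_summable. Qed.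

Lemma iter_eigen i j : iter j A (e i) = nu i ^+ j *: e i.
Proof.
have [de Ae] := e_eigen i; have [d0 _] := dom_linear A.
elim: j => [|j IH]; first by rewrite expr0 scale1r.
rewrite iterS IH -[nu i ^+ j *: e i]addr0 op_linear// op0 addr0 Ae scalerA.
by rewrite exprSr.
Qed.

Lemma smooth_eigen i : smooth_dom A (e i).
Proof.
apply/smooth_domP => j; rewrite iter_eigen -[_ *: _]addr0.
by have [d0 dl] := dom_linear A; apply: dl => //; case: (e_eigen i).
Qed.

Lemma smooth_sum (h : I -> R[i]) (s : seq I) :
  smooth_dom A (\sum_(i <- s) h i *: e i) /\
  forall j, iter j A (\sum_(i <- s) h i *: e i) =
            \sum_(i <- s) (h i * nu i ^+ j) *: e i.
Proof.
elim: s => [|i s [sS ES]].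
  by rewrite big_nil; split=> [|j]; [exact: smooth0|rewrite iter_op0 big_nil].
have [sD ED] := smooth_iter_linear (h i) (smooth_eigen i) sS.
rewrite big_cons; split=> // j.
by rewrite ED ES big_cons iter_eigen scalerA.
Qed.

Lemma iter_inner j f i : smooth_dom A f ->
  L2inner (iter j A f) (e' i) = nu i ^+ j * L2inner f (e' i).
Proof.
move=> /smooth_domP sf; elim: j => [|j IH]; first by rewrite mul1r.
by rewrite iterS e'_eigen// IH mulrA exprS.
Qed.

Lemma cmodX (z : R[i]) j : cmod (z ^+ j) = cmod z ^+ j.
Proof.
by elim: j => [|j IH]; rewrite ?Normc.normc1// !exprS Normc.normcM IH.
Qed.

(** From w^m <= 1 + |nu| one gets w^k <= (1 + |nu|)^k <= 2^k (1 + |nu|^k), and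
    |nu|^j times the coefficient of f is the coefficient of A^j f, which
    Cauchy-Schwarz bounds by b ||A^j f||; it is used for j = 0 and j = k. *)
Lemma fourier_decay k f i : smooth_dom A f ->
  w i ^+ k * cmod (fourier e' f i) <= (2 ^+ k.+1 * b) * graph_norm A k f.
Proof.
move=> sf; set z := cmod (nu i).
have z0 : 0 <= z by exact: cmod_ge0.
have wk : w i ^+ k <= 2 ^+ k * (1 + z ^+ k).
  apply: (@le_trans _ _ ((1 + z) ^+ k)).
    apply: le_trans (lerXn2r k _ _ (w_le i)); rewrite ?nnegrE ?exprn_ge0 ?addr_ge0//.
    by rewrite -exprM ler_weXn2l// leq_pmull.
  have [z1|z1] := leP z 1.
    apply: (@le_trans _ _ (2 ^+ k)).
      by apply: lerXn2r; rewrite ?nnegrE ?addr_ge0//; lra.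
    by rewrite ler_peMr ?exprn_ge0// lerDl exprn_ge0.
  apply: (@le_trans _ _ ((2 * z) ^+ k)).
    by apply: lerXn2r; rewrite ?nnegrE ?addr_ge0 ?mulr_ge0//; lra.
  by rewrite exprMn ler_wpM2l ?exprn_ge0// lerDr.
have B j : (j <= k)%N -> z ^+ j * cmod (fourier e' f i) <= graph_norm A k f * b.
  move=> jk; rewrite -cmodX -Normc.normcM /fourier -iter_inner//.
  apply: le_trans (L2_Cauchy_Schwarz _ _) _.
  by apply: ler_pM; rewrite ?L2norm_ge0//; exact: graph_norm_ge.
apply: (@le_trans _ _ (2 ^+ k * (1 + z ^+ k) * cmod (fourier e' f i))).
  by rewrite ler_wpM2r ?cmod_ge0.
rewrite -!mulrA mulrDl exprSr -mulrA ler_wpM2l ?exprn_ge0//.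
have := B 0%N (leq0n k); have := B k (leqnn k); rewrite expr0; lra.
Qed.

Lemma fourier_rapidly_decreasing f : smooth_dom A f ->
  rapidly_decreasing w (fourier e' f).
Proof.
move=> sf; apply/rapidly_decreasingP => // k.
by exists ((2 ^+ k.+1 * b) * graph_norm A k f) => i; exact: fourier_decay.
Qed.

(** For j <= k the j-th iterate multiplies the i-th term by nu_i^j, which is at
    most w_i^(m k) in modulus.  The additional factor w_i^N0 in the bound on h
    pays for the summable factor c_i. *)
Lemma sum_graph_norm k (h : I -> R[i]) (Q : R) (s : seq I) :
  (forall i, w i ^+ (m * k + N0) * cmod (h i) <= Q) ->
  graph_norm A k (\sum_(i <- s) h i *: e i) <= b * Q * \sum_(i <- s) c i.
Proof.
move=> hQ.
have term i j : (j <= k)%N -> L2norm ((h i * nu i ^+ j) *: e i) <= b * Q * c i.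
  move=> jk; rewrite L2normZ Normc.normcM cmodX mulrC -mulrA.
  apply: ler_pM; rewrite ?L2norm_ge0 ?mulr_ge0 ?cmod_ge0 ?exprn_ge0 ?cmod_ge0//.
  apply: (@le_trans _ _ (w i ^+ (m * k + N0) * cmod (h i) * c i)); last first.
    by rewrite ler_wpM2r.
  rewrite mulrC mulrAC exprD.
  rewrite ler_wpM2r ?cmod_ge0//.
  apply: (@le_trans _ _ (w i ^+ (m * k))).
    apply: (@le_trans _ _ ((w i ^+ m) ^+ j)).
      by apply: lerXn2r; rewrite ?nnegrE ?cmod_ge0 ?exprn_ge0.
    by rewrite -exprM ler_weXn2l// leq_mul2l jk orbT.
  by rewrite -mulrA ler_peMr// exprn_ge0.
apply: graph_norm_le => [|j jk].
  case: s => [|i s]; first by rewrite big_nil mulr0.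
  rewrite mulr_ge0 ?sumr_ge0// mulr_ge0//.
  by apply: le_trans (hQ i); rewrite mulr_ge0 ?cmod_ge0// exprn_ge0.
have [_ ->] := smooth_sum h s.
apply: le_trans (L2norm_sum _ _ _) _.
by rewrite mulr_sumr; apply: ler_sum => i _; exact: term.
Qed.

Lemma rapidly_decreasing_summable h : rapidly_decreasing w h ->
  summable_weight (fun i => cmod (h i)).
Proof.
move=> /rapidly_decreasingP-/(_ w1 N0)[Q hQ].
split=> [i|]; first exact: cmod_ge0.
have [_ [M cM]] := c_summable.
exists (`|Q| * M) => s.
apply: (@le_trans _ _ (\sum_(i <- s) `|Q| * c i)).
  apply: ler_sum => i _.
  apply: (@le_trans _ _ ((w i ^+ N0 * c i) * cmod (h i))).
    by rewrite ler_peMl ?cmod_ge0.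
  rewrite mulrAC ler_wpM2r//; apply: le_trans (hQ i) (ler_norm _).
by rewrite -mulr_sumr ler_wpM2l.
Qed.

(** Beyond a large finite set of indices the sum of c is small, whence so is the
    graph norm of the remaining terms. *)
Lemma partial_sum_tail k h (eps : R) : rapidly_decreasing w h -> 0 < eps ->
  exists s0 : {fset I}, forall s : {fset I}, (s0 `<=` s)%fset ->
    graph_norm A k (\sum_(i <- s) h i *: e i - \sum_(i <- s0) h i *: e i) < eps.
Proof.
move=> rh eps0.
have /rapidly_decreasingP-/(_ w1 (m * k + N0)%N)[Q hQ] := rh.
pose C := b * `|Q| + 1.
have C0 : 0 < C by rewrite ltr_wpDl// mulr_ge0.
have [|s0 s0P] := @summable_tail _ _ c (eps / C) c_summable; first exact: divr_gt0.
exists s0 => s s0s; rewrite (sum_fsetD _ s0s) addrAC subrr add0r.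
have hQ' i : w i ^+ (m * k + N0) * cmod (h i) <= `|Q|.
  exact: le_trans (hQ i) (ler_norm _).
apply: (le_lt_trans (sum_graph_norm _ hQ')).
apply: (@le_lt_trans _ _ (C * \sum_(i <- (s `\` s0)%fset) c i)).
  by rewrite ler_wpM2r ?sumr_ge0// lerDl.
rewrite -ltr_pdivlMl// mulrC; apply: s0P.
by apply/fdisjointP => i is0; rewrite in_fsetD is0.
Qed.

(** Convergence to g of the finite partial sums in each graph norm determines g,
    so that this relation is the graph of the inverse transform. *)
Definition synthesizes (h : I -> R[i]) (g : H) : Prop :=
  smooth_dom A g /\ forall k (eps : R), 0 < eps ->
    exists s0 : {fset I}, forall s : {fset I}, (s0 `<=` s)%fset ->
      graph_norm A k (\sum_(i <- s) h i *: e i - g) < eps.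

(** The partial sums along an exhausting sequence are Cauchy in each graph norm
    and converge by completeness; small tails carry the convergence over from
    the sequence to the net of all finite sets. *)
Lemma synthesis_exists h : rapidly_decreasing w h -> exists g, synthesizes h g.
Proof.
move=> rh; have [B [Bmono Bcover]] := fset_exhaustion cI.
pose S (s : {fset I}) := \sum_(i <- s) h i *: e i.
have sS s : smooth_dom A (S s) by case: (smooth_sum h s).
pose F n : smooth_space A := SigSub (mem_set (sS (B n))).
have [|g Fg] := @A_closed F.
  move=> k eps eps0.
  have [s0 s0P] := partial_sum_tail k rh (divr_gt0 eps0 (ltr0Sn R 1)).
  have [N s0N] := Bcover s0; exists N => i j Ni Nj.
  have Pi := s0P _ (fsubset_trans s0N (Bmono _ _ Ni)).
  have Pj := s0P _ (fsubset_trans s0N (Bmono _ _ Nj)).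
  apply: (le_lt_trans (graph_norm_triangle k (sS (B i)) (sS s0) (sS (B j)))).
  by rewrite (splitr eps) ltrD// graph_normC.
have sg : smooth_dom A (smooth_val g) := set_valP g.
exists (smooth_val g); split=> // k eps eps0.
have e3 : 0 < eps / 3 by rewrite divr_gt0.
have [s0 s0P] := partial_sum_tail k rh e3.
have [N s0N] := Bcover s0.
have /Fg : nbhs g [set f | graph_norm A k (smooth_val g - smooth_val f) < eps / 3].
  apply: open_nbhs_nbhs; split; last by rewrite /= subrr graph_norm0.
  exact: gauge_ball_open.
case=> N1 _ /(_ (maxn N N1) (leq_maxr _ _)) /= PN.
exists s0 => s s0s.
have Ps := s0P s s0s.
have Pm := s0P _ (fsubset_trans s0N (Bmono _ _ (leq_maxl N N1))).
apply: (le_lt_trans (graph_norm_triangle k (sS s) (sS s0) sg)).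
have := graph_norm_triangle k (sS s0) (sS (B (maxn N N1))) sg.
rewrite (graph_normC k (sS _) (sS _)) in Pm.
rewrite (graph_normC k sg (sS (B (maxn N N1)))) in PN.
rewrite /S in Ps Pm PN *; lra.
Qed.

(** A partial sum over a set that contains j has j-th coefficient h_j by
    biorthogonality, and coefficients are continuous for the L^2 norm. *)
Lemma synthesis_fourier h g : synthesizes h g -> fourier e' g = h.
Proof.
move=> [sg hg]; apply/funext => j.
suff : cmod (fourier e' g j - h j) <= 0.
  move=> le0; apply/eqP; rewrite -subr_eq0; apply/eqP/Normc.eq0_normc.
  by apply/eqP; rewrite eq_le le0 cmod_ge0.
apply/ler_addgt0Pl => eps eps0; rewrite addr0.
have b1 : 0 < b + 1 by rewrite ltr_wpDl.
have [s0 s0P] := hg 0%N (eps / (b + 1)) (divr_gt0 eps0 b1).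
pose s := (j |` s0)%fset.
have := s0P s (fsubsetU1 _ _).
set S := \sum_(i <- s) _ => PS.
have ES : L2inner S (e' j) = h j.
  have -> : L2inner S (e' j) = \sum_(i <- s) h i * L2inner (e i) (e' j).
    rewrite /S; elim/big_rec2 : _ => [|i x y _ <-]; first by rewrite L2inner0l.
    by rewrite L2innerDl.
  rewrite (big_fsetD1 j) ?fset1U1//= biorth eqxx mulr1 big1_fset ?addr0// => i.
  by rewrite in_fsetD1 => /andP[ij _] _; rewrite biorth (negbTE ij) mulr0.
have -> : fourier e' g j - h j = - L2inner (S - g) (e' j).
  by rewrite L2innerB ES opprB.
rewrite normcN; apply: le_trans (L2_Cauchy_Schwarz _ _) _.
have n0 : L2norm (S - g) <= eps / (b + 1).
  by apply: le_trans (ltW PS); exact: (graph_norm_ge A (S - g) (leqnn 0)).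
apply: (@le_trans _ _ (eps / (b + 1) * (b + 1))); last by rewrite divfK// gt_eqF.
apply: ler_pM; rewrite ?L2norm_ge0//.
by apply: le_trans (e'_bounded j) _; rewrite lerDl.
Qed.

Lemma fourier_inj f g : smooth_dom A f -> smooth_dom A g ->
  fourier e' f = fourier e' g -> f = g.
Proof.
move=> sf sg fg; apply/eqP; rewrite -subr_eq0; apply/eqP/e'_total => i.
have := congr1 (@^~ i) fg; rewrite /fourier => fgi.
by rewrite L2innerB fgi subrr.
Qed.

Lemma fourierB f g : fourier e' (f - g) = fourier e' f - fourier e' g.
Proof.
by apply/funext => i; rewrite /fourier L2innerB.
Qed.

(** The partial sums of h - h' obey [sum_graph_norm] with a constant independent
    of the set of indices, so that the estimate passes to the limit. *)
Lemma synthesis_continuous k : exists C : R, 0 <= C /\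
  forall h h' g g', rapidly_decreasing w h -> rapidly_decreasing w h' ->
    synthesizes h g -> synthesizes h' g' ->
    graph_norm A k (g - g') <= C * schwartz_norm w (m * k + N0) (h - h').
Proof.
have [_ [M cM]] := c_summable.
have M0 : 0 <= M by apply: le_trans (cM fset0); rewrite big_seq_fset0.
exists (b * M); split=> [|h h' g g' rh rh' [sg hg] [sg' hg']]; first exact: mulr_ge0.
apply/ler_addgt0Pl => eps eps0.
have [s1 P1] := hg k (eps / 2) (divr_gt0 eps0 (ltr0Sn R 1)).
have [s2 P2] := hg' k (eps / 2) (divr_gt0 eps0 (ltr0Sn R 1)).
pose s := (s1 `|` s2)%fset.
have := P1 s (fsubsetUl _ _); have := P2 s (fsubsetUr _ _).
have [sS _] := smooth_sum h s; have [sS' _] := smooth_sum h' s.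
have rB := rapidly_decreasingB w1 rh rh'.
have := sum_graph_norm s (fun i => schwartz_norm_ge w1 (m * k + N0) i rB).
have -> : \sum_(i <- s) (h - h') i *: e i =
    \sum_(i <- s) h i *: e i - \sum_(i <- s) h' i *: e i.
  rewrite -sumrB; apply: eq_bigr => i _.
  by rewrite -scalerBl.
set S := \sum_(i <- s) h i *: e i; set S' := \sum_(i <- s) h' i *: e i.
set q := schwartz_norm _ _ _ => PS P2s P1s.
have q0 : 0 <= q by exact: schwartz_norm_ge0.
have PS' : graph_norm A k (S - S') <= b * M * q.
  apply: le_trans PS _; rewrite -mulrA -mulrA ler_wpM2l// [leRHS]mulrC.
  by rewrite ler_wpM2l.
have t1 := graph_norm_triangle k sg sS sg'.
have t2 := graph_norm_triangle k sS sS' sg'.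
rewrite [graph_norm A k (g - S)]graph_normC// in t1.
lra.
Qed.

(** The inverse map chooses a synthesis of each family.  Both compositions are
    identities because coefficients are recovered by [synthesis_fourier] and
    determine the vector by [fourier_inj]. *)
Theorem eigenfunction_fourier_homeomorphism : fourier_homeomorphism A e e' w.
Proof.
have sv (f : smooth_space A) : smooth_dom A (smooth_val f) := set_valP f.
have rv (h : schwartz w) : rapidly_decreasing w (schwartz_val h) := set_valP h.
pose F (f : smooth_space A) : schwartz w :=
  SigSub (mem_set (fourier_rapidly_decreasing (sv f))).
have ex (h : schwartz w) := cid (synthesis_exists (rv h)).
pose G (h : schwartz w) : smooth_space A := SigSub (mem_set (projT2 (ex h)).1).
have Gs h : synthesizes (schwartz_val h) (smooth_val (G h)) := projT2 (ex h).
have FE f : schwartz_val (F f) = fourier e' (smooth_val f) by [].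
have FK : cancel F G.
  move=> f; apply: val_inj; apply: fourier_inj; [exact: (sv (G (F f)))|exact: sv|].
  exact: (synthesis_fourier (Gs (F f))).
have GK : cancel G F.
  by move=> h; apply: val_inj; exact: (synthesis_fourier (Gs h)).
have Gexp h : expansion A (schwartz_val h) e (smooth_val (G h)).
  have [sg hg] := Gs h; split=> [k|].
    by apply: totally_cvg0 => [s|eps eps0]; [exact: graph_norm_ge0|exact: hg].
  apply: (ae_expansion cI e_bounded) => [|eps eps0].
    exact: rapidly_decreasing_summable.
  have [s0 s0P] := hg 0%N eps eps0; exists s0 => s s0s.
  apply: le_lt_trans (s0P s s0s); exact: (graph_norm_ge A _ (leqnn 0)).
exists F, G; split=> //.
- split.
    apply: gauge_continuous => [k f|k f g h|k].
    + by rewrite subrr graph_norm0.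
    + have -> : val f - val h = (val f - val g) + (val g - val h).
        by rewrite addrA subrK.
      by apply: schwartz_normD => //; apply: rapidly_decreasingB => //; exact: rv.
    + exists k, (2 ^+ k.+1 * b); split; first by rewrite mulr_ge0 ?exprn_ge0.
      move=> f g; rewrite -[X in schwartz_norm _ _ X]fourierB.
      have sB := smoothB (sv f) (sv g).
      apply: schwartz_norm_le => [|i]; last exact: fourier_decay.
      by rewrite mulr_ge0 ?graph_norm_ge0// mulr_ge0// exprn_ge0.
  apply: gauge_continuous => [k h|k f g h|k].
  + by rewrite subrr schwartz_norm0.
  + by apply: graph_norm_triangle; exact: sv.
  + have [C [C0 CP]] := synthesis_continuous k.
    by exists (m * k + N0)%N, C; split=> // h h'; exact: (CP _ _ _ _ (rv h) (rv h') (Gs h) (Gs h')).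
- by move=> f; have := Gexp (F f); rewrite FK.
Qed.

End eigenfunction_expansion.

(** * Weights and Riesz bases *)

Section japanese_weight.
Context {R : realType} {I : choiceType} (m : nat) (lam : I -> R[i]).
Hypothesis m1 : (1 <= m)%N.

Lemma japanese_ge1 i : 1 <= japanese m lam i.
Proof.
have := @ler_powR R (1 + cmod (lam i) ^+ 2) _ 0 (2 * m%:R)^-1.
rewrite powRr0; apply; first by rewrite lerDl sqr_ge0.
by rewrite invr_ge0 mulr_ge0.
Qed.

(** The exponent 1/(2m) is chosen so that the m-th power of the weight is
    comparable with |lam|. *)
Lemma japanese_expn i :
  japanese m lam i ^+ m = Num.sqrt (1 + cmod (lam i) ^+ 2).
Proof.
rewrite -powR_mulrn ?powR_ge0// -powRrM invfM -mulrA mulVf ?mulr1.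
  by rewrite powR12_sqrt// addr_ge0// sqr_ge0.
by rewrite pnatr_eq0 -lt0n.
Qed.

Lemma cmod_le_japanese i : cmod (lam i) <= japanese m lam i ^+ m.
Proof.
rewrite japanese_expn -[leLHS]ger0_norm ?cmod_ge0// -sqrtr_sqr.
by apply: ler_wsqrtr; rewrite lerDr.
Qed.

Lemma japanese_le_cmod i : japanese m lam i ^+ m <= 1 + cmod (lam i).
Proof.
have l0 := cmod_ge0 (lam i).
rewrite japanese_expn -[leRHS]ger0_norm ?addr_ge0// -sqrtr_sqr.
by apply: ler_wsqrtr; nra.
Qed.

End japanese_weight.

Section riesz_bases.
Context d (T : measurableType d) (R : realType).
Variable mu : {measure set T -> \bar R}.
Local Notation H := (L2 mu).
Context {I : choiceType}.

(** The upper Riesz inequality for a single vector with coefficient 1. *)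
Lemma riesz_basis_bounded (e : I -> H) : riesz_basis e ->
  exists b : R, 0 <= b /\ forall i, L2norm (e i) <= b.
Proof.
move=> [[a [b [a0 b0 H]]] _]; exists (Num.sqrt b); split=> [|i].
  exact: sqrtr_ge0.
have [_] := H [fset i]%fset (fun=> 1).
rewrite !big_seq_fset1 scale1r Normc.normc1 expr1n mulr1.
move=> eb; rewrite -[leLHS]ger0_norm ?L2norm_ge0// -sqrtr_sqr.
exact: ler_wsqrtr.
Qed.

(** If S is a finite combination of the e_i at distance at most eps from f, then
    S is orthogonal to f, so that ||f||^2 = (f - S, f) <= eps ||f||. *)
Lemma riesz_basis_total (e : I -> H) (f : H) : riesz_basis e ->
  (forall i, L2inner f (e i) = 0) -> f = 0.
Proof.
move=> [_ dense] fe; apply: L2norm_eq0; apply/eqP.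
rewrite eq_le L2norm_ge0 andbT; apply/ler_addgt0Pl => eps eps0; rewrite addr0.
have [s [c fs]] := dense f eps eps0; set S := \sum_(i <- s) _ in fs.
have fS : L2inner f S = 0.
  rewrite L2innerC (_ : L2inner S f = 0) ?conjc0// /S.
  elim/big_rec : _ => [|i x _ IH]; first exact: L2inner0l.
  by rewrite L2innerDl IH addr0 L2innerC fe conjc0 mulr0.
have := L2_Cauchy_Schwarz (f - S) f.
rewrite L2innerB [L2inner S f]L2innerC fS conjc0 subr0 L2inner_diag /=.
rewrite expr0n /= addr0 sqrtr_sqr ger0_norm ?sqr_ge0// expr2.
have [->|f0] := eqVneq (L2norm f) 0; first by move=> _; exact: ltW.
rewrite ler_pM2r; last by rewrite lt_neqAle eq_sym f0 L2norm_ge0.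
by move=> /le_trans; apply; exact: ltW.
Qed.

End riesz_bases.

Lemma countable_set_type (X : countType) (I : set X) : countable [set: I].
Proof.
have /countable_injP[f finj] := countableP [set: X].
apply/countable_injP; exists (fun i : I => f (\val i)) => i j _ _ fij.
by apply: val_inj; apply: finj fij; exact: in_setT.
Qed.

(** * The transforms of an operator and of its adjoint *)

(** The hypothesis on L2inner (A f) (e' i) expresses that e' i is an eigenvector
    of the adjoint; in this form it holds for the operator and for its adjoint
    alike. *)
Lemma riesz_fourier_homeomorphism d (T : measurableType d) (R : realType)
    (mu : {measure set T -> \bar R}) (I : choiceType) (A : operator (L2 mu))
    (e e' : I -> L2 mu) (nu : I -> R[i]) (m : nat) (s0 : R) :
  (1 <= m)%N -> countable [set: I] ->
  (forall i, dom A (e i) /\ A (e i) = nu i *: e i) ->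
  (forall f i, dom A f -> L2inner (A f) (e' i) = nu i * L2inner f (e' i)) ->
  (forall i j, L2inner (e i) (e' j) = (i == j)%:R) ->
  riesz_basis e -> riesz_basis e' ->
  (\esum_(i in [set: I]) (japanese m nu i `^ (- s0))%:E < +oo)%E ->
  closed_under_limits A ->
  fourier_homeomorphism A e e' (japanese m nu).
Proof.
move=> m1 cI eig eig' bio re re' sw cl.
have [b [b0 eb]] := riesz_basis_bounded re.
have [b' [b0' eb']] := riesz_basis_bounded re'.
have w1 := japanese_ge1 m nu.
have w0 i : 0 <= japanese m nu i by rewrite (le_trans _ (w1 i)).
apply: (@eigenfunction_fourier_homeomorphism _ _ _ _ _ A e e' nu _
  (fun i => japanese m nu i `^ (- s0)) (Num.max b b') m (Num.truncn s0).+1) => //.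
- by move=> i; rewrite le_max eb.
- by move=> i; rewrite le_max eb' orbT.
- by move=> f; exact: riesz_basis_total.
- by rewrite le_max b0.
- by move=> i; exact: cmod_le_japanese.
- by move=> i; exact: japanese_le_cmod.
- by apply: esum_summable => // i; exact: powR_ge0.
(* Any integer N0 >= s0 gives w^N0 * w^(- s0) >= 1. *)
- move=> i; rewrite -powR_mulrn// -powRD; last first.
    by apply/implyP => _; rewrite gt_eqF// (lt_le_trans _ (w1 i)).
  have := @ler_powR R (japanese m nu i) (w1 i) 0.
  rewrite powRr0; apply.
  by rewrite subr_ge0; exact/ltW/truncnS_gt.
Qed.

Theorem proposition4p2 (R : realType) (n : nat) (n_ge1 : (1 <= n)%N)
  (Omega : set 'rV[R]_n) (Omega_open : open Omega)
  (Omega_bounded : bounded_set Omega)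
  (m : nat) (m_ge1 : (1 <= m)%N)
  (a : {ffun 'I_n -> 'I_m.+1} -> 'rV[R]_n -> R[i])
  (a_smooth : smooth_coefs_order Omega a)
  (BC : set (L2 (leb_on Omega_open)))
  (L Lstar : operator (L2 (leb_on Omega_open)))
  (L_bvp : boundary_operator a BC L)
  (L_adjoint : is_adjoint L Lstar)
  (K : nat) (I : set 'rV[int]_K)
  (lam : I -> R[i]) (u v : I -> L2 (leb_on Omega_open))
  (L_spectrum : discrete_spectrum L lam u)
  (lam_ordered : forall j k : I,
    lattice_norm R (\val j) <= lattice_norm R (\val k) ->
    cmod (lam j) <= cmod (lam k))
  (u_eigen : forall xi, dom L (u xi) /\ L (u xi) = lam xi *: u xi)
  (v_eigen : forall xi, dom Lstar (v xi) /\
    Lstar (v xi) = conjc (lam xi) *: v xi)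
  (u_norm1 : forall xi, L2norm (u xi) = 1)
  (uv_biorthogonal : forall xi eta, L2inner (u xi) (v eta) = (xi == eta)%:R)
  (u_riesz : riesz_basis u) (v_riesz : riesz_basis v)
  (s0 : R)
  (weights_summable :
    (\esum_(xi in [set: I]) (japanese m lam xi `^ (- s0))%:E < +oo)%E)
  (L_closed : closed_under_limits L)
  (Lstar_closed : closed_under_limits Lstar) :
  fourier_homeomorphism L u v (japanese m lam) /\
  fourier_homeomorphism Lstar v u (japanese m lam).
Proof.
have [_ adj] := L_adjoint; have cI := @countable_set_type 'rV[int]_K I.
split.
  apply: (riesz_fourier_homeomorphism (s0 := s0)) => // f i df.
  have [dv Lv] := v_eigen i.
  by rewrite adj// Lv L2innerZr conjcK.
(* The eigenvalues of the adjoint are conjugate to those of L, which leaves the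
   weights unchanged. *)
have jE : japanese m lam = japanese m (fun i => conjc (lam i)).
  by apply/funext => i; rewrite /japanese !cmod_sq; case: (lam i) => p q /=; rewrite sqrrN.
rewrite jE in weights_summable *.
apply: (riesz_fourier_homeomorphism (s0 := s0)) => // [f i df|i j].
  have [du Lu] := u_eigen i.
  by rewrite L2innerC -adj// Lu L2innerZ rmorphM [in RHS]L2innerC.
by rewrite L2innerC uv_biorthogonal eq_sym conjc_nat.
Qed.
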